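(* Let $\{(R_n,B_n)\}_{n=1}^\infty$ be a sequence of admissible pairs in $\mathbb{R}^d$. Let $$\mu_n=\delta_{R_1^{-1}B_1}*\delta_{(R_2R_1)^{-1}B_2}*\cdots*\delta_{(R_n\cdots R_2R_1)^{-1}B_n},$$ and suppose that $\mu_n$ converges weakly to a Borel probability measure $\mu$. Suppose moreover that $\lim_{n\to\infty}\|R_1^{-1}R_2^{-1}\cdots R_n^{-1}\|=0$. For $n\ge1$ let $$\nu_{>n}=\delta_{R_{n+1}^{-1}B_{n+1}}*\delta_{(R_{n+2}R_{n+1})^{-1}B_{n+2}}*\cdots .$$ If some subsequence $\{\nu_{>n_j}\}$ converges weakly to a Borel probability measure $\nu$ with $\mathcal{Z}(\nu)=\emptyset$, then $\mu$ is a spectral measure with a spectrum contained in $\mathbb{Z}^d$.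
   Context: A Borel probability measure $\mu$ on $\mathbb{R}^d$ is a spectral measure if there is a countable set $\Lambda\subseteq\mathbb{R}^d$ (a spectrum) such that $\{e^{2\pi i\lambda\cdot x}:\lambda\in\Lambda\}$ is an orthonormal basis of $L^2(\mu)$. For a finite $A\subseteq\mathbb{R}^d$, $\delta_A=\frac{1}{\#A}\sum_{a\in A}\delta_a$. A pair $(R,B)$ with $R$ a $d\times d$ expanding integer matrix and $B\subseteq\mathbb{Z}^d$ finite is an admissible pair if there is a finite $L\subseteq\mathbb{Z}^d$ with $\#L=\#B$ such that $\big[\frac{1}{\sqrt{\#B}}e^{-2\pi i(R^{-1}b)\cdot\ell}\big]_{b\in B,\ell\in L}$ is unitary. The tail $\nu_{>n}$ is the weak limit of the finite convolutions $\delta_{R_{n+1}^{-1}B_{n+1}}*\cdots*\delta_{(R_{n+k}\cdots R_{n+1})^{-1}B_{n+k}}$ as $k\to\infty$. With $\widehat{\nu}(\xi)=\int e^{-2\pi i\xi\cdot x}d\nu(x)$, the integral periodic zero set is $\mathcal{Z}(\nu)=\{\xi\in\mathbb{R}^d:\widehat{\nu}(\xi+k)=0\text{ for all }k\in\mathbb{Z}^d\}$. *)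

(* Defs.v *)
From HB Require Import structures.
From mathcomp Require Import all_boot all_order all_algebra.
From mathcomp Require Import all_classical all_reals all_analysis.
From mathcomp Require Import complex.
Set Implicit Arguments.
Unset Strict Implicit.
Unset Printing Implicit Defensive.
Import Order.TTheory GRing.Theory Num.Theory.
Import numFieldNormedType.Exports.
Local Open Scope ring_scope.
Local Open Scope classical_set_scope.

Section Defs.
Variables (R : realType) (d : nat).

Notation vec := 'cV[R]_d.

Definition intmx m n (M : 'M[int]_(m, n)) : 'M[R]_(m, n) :=
  map_mx (fun k : int => k%:~R) M.

Definition dotv (x y : vec) : R := \sum_(i < d) x i 0 * y i 0.

Definition Zd : set vec := [set x | exists k : 'cV[int]_d, x = intmx k].

Definition expanding (M : 'M[int]_d) : Prop :=
  forall z : R[i], root (char_poly (map_mx (fun k : int => (k%:~R : R[i])) M)) z ->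
    1 < `|z|.

Definition expi (t : R) : R[i] := Complex (cos t) (sin t).

Definition unitary n (U : 'M[R[i]]_n) : Prop :=
  U *m (map_mx (@conjc R) U)^T = 1%:M.

Definition admissible (M : 'M[int]_d) (B : seq 'cV[int]_d) : Prop :=
  expanding M /\ uniq B /\
  exists L : seq 'cV[int]_d, uniq L /\ size L = size B /\
    unitary (\matrix_(i < size B, j < size B)
      ((Complex (Num.sqrt (size B)%:R)^-1 0) *
       expi (- (2 * pi * dotv (invmx (intmx M) *m intmx (nth 0 B i))
                              (intmx (nth 0 L j)))))).

Variables (Rs : nat -> 'M[int]_d) (Bs : nat -> seq 'cV[int]_d).

(* prodR m j = R_{m+j} ... R_{m+1}  (1-based indices: Rs k is R_{k+1}). *)
Fixpoint prodR (m j : nat) : 'M[R]_d :=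
  if j is j'.+1 then intmx (Rs (m + j')) *m prodR m j' else 1%:M.

Fixpoint invprod (n : nat) : 'M[R]_d :=
  if n is n'.+1 then invprod n' *m invmx (intmx (Rs n')) else 1%:M.

(* The j-th digit set (j >= 1) of the tail starting after m:
   (R_{m+j} ... R_{m+1})^{-1} B_{m+j}. *)
Definition digits (m j : nat) : seq vec :=
  [seq invmx (prodR m j) *m intmx b | b <- Bs (m + j.-1)].

(* Multiset of atoms of delta_{A_1} * ... * delta_{A_k} (each atom has mass
   1/size): the list of all sums a_1 + ... + a_k with a_j in digits m j. *)
Fixpoint convpts (m k : nat) : seq vec :=
  if k is k'.+1 then [seq x + y | x <- convpts m k', y <- digits m k]
  else [:: 0].

(* Integral of f against the uniform probability on the multiset s. *)
Definition avg (s : seq vec) (f : vec -> R) : R :=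
  (size s)%:R^-1 * \sum_(x <- s) f x.

End Defs.

Section Meas.
Variables (R : realType) (d : nat).
Notation vec := 'cV[R]_d.

Definition Rd := g_sigma_algebraType (@open vec).

Definition bounded_continuous (f : vec -> R) : Prop :=
  continuous f /\ exists M : R, forall x, `|f x| <= M.

Definition weak_conv_pts (s : nat -> seq vec) (P : probability Rd R) : Prop :=
  forall f, bounded_continuous f ->
    (fun n => avg (s n) f) @ \oo --> Rintegral P setT f.

Definition weak_conv (Ps : nat -> probability Rd R) (P : probability Rd R) : Prop :=
  forall f, bounded_continuous f ->
    (fun n => Rintegral (Ps n) setT f) @ \oo --> Rintegral P setT f.

(* \hat nu(xi) = int e^{-2 pi i xi.x} dnu(x) = 0, i.e. both real and
   imaginary parts vanish. *)
Definition fourier_zero (P : probability Rd R) (xi : vec) : Prop :=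
  Rintegral P setT (fun x => cos (2 * pi * dotv xi x)) = 0 /\
  Rintegral P setT (fun x => sin (2 * pi * dotv xi x)) = 0.

Definition Zset (P : probability Rd R) : set vec :=
  [set xi | forall k, Zd k -> fourier_zero P (xi + k)].

(* Lambda is a spectrum of mu: Lambda countable, {e_lambda} orthonormal in
   L^2(mu) and complete (the only f = u + i v in L^2(mu) orthogonal to every
   e_lambda is f = 0 mu-a.e.). Here e_lambda(x) = cos(2pi l.x) + i sin(2pi l.x),
   <e_l, e_l'> = int e^{2 pi i (l - l').x} dmu,
   <f, e_l> = int (u cos + v sin) + i int (v cos - u sin). *)
Definition is_spectrum (P : probability Rd R) (Lam : set vec) : Prop :=
  countable Lam /\
  (forall l l', Lam l -> Lam l' ->
     Rintegral P setT (fun x => cos (2 * pi * dotv (l - l') x)) = (l == l')%:R /\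
     Rintegral P setT (fun x => sin (2 * pi * dotv (l - l') x)) = 0) /\
  (forall u v : Rd -> R,
     measurable_fun setT u -> measurable_fun setT v ->
     P.-integrable setT (fun x => (u x ^+ 2)%:E) ->
     P.-integrable setT (fun x => (v x ^+ 2)%:E) ->
     (forall l, Lam l ->
        Rintegral P setT (fun x => u x * cos (2 * pi * dotv l x)
                                    + v x * sin (2 * pi * dotv l x)) = 0 /\
        Rintegral P setT (fun x => v x * cos (2 * pi * dotv l x)
                                    - u x * sin (2 * pi * dotv l x)) = 0) ->
     {ae P, forall x, u x = 0 /\ v x = 0}).

Definition spectral_measure (P : probability Rd R) : Prop :=
  exists Lam : set vec, is_spectrum P Lam.

End Meas.

(* Main.v *)
(** The measure [mu] is the convolution of the finitely supported measure
    [mu_n] with the contracted tail [nu_{>n}].  Each [mu_n] has a finite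
    spectrum, unique only modulo the lattice generated by [(R_n...R_1)^T].  As
    [Z(nu)] is empty, compactness of the unit cube bounds the Fourier transforms
    of [nu_{>n_j}] below, uniformly in large [j], at some integer translate of
    every frequency, so the finite spectra can be shifted to an increasing
    sequence [La_i] on which the Fourier transform of the rescaled tail has
    squared modulus at least [e].  Their union [Lam] is orthonormal for [mu].

    Completeness: given a bounded Lipschitz [phi], let [a_l] be its Fourier
    coefficients with respect to [mu_n] on [La_i] and divide them by the
    transform of the tail to get a trigonometric polynomial [T] with
    [||T||^2 <= ||phi||^2 / e] and [<phi, T>_mu] close to [||phi||^2].  If [f] is
    orthogonal to [Lam] then [<phi, T> = <phi - f, T>], hence
    [||phi||^2 <= C ||phi - f||^2] with [C] depending only on [e].  Bounded
    Lipschitz functions are dense in [L^2(mu)], so [f = 0]. *)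

Require Import Defs.
From HB Require Import structures.
From mathcomp Require Import all_boot all_order all_algebra.
From mathcomp Require Import all_classical all_reals all_analysis.
From mathcomp Require Import measurable_realfun complex.
From mathcomp Require Import ring lra.
Set Implicit Arguments.
Unset Strict Implicit.
Unset Printing Implicit Defensive.
Import Order.TTheory GRing.Theory Num.Theory.
Import numFieldNormedType.Exports.
Local Open Scope ring_scope.
Local Open Scope classical_set_scope.

(** The transforms of the tails are bounded below only at vectors [xi + k + y] with [k] integral,
    depending on [xi], and [y] short. When a spectrum [La] is enlarged, its old frequencies are seen
    by a later tail through [(R_1^-1 ... R_n^-1)^T] and play the role of [y]; they are short only
    for large [n], so the next level must be chosen after [La]. They survive unshifted because the
    translate at [xi = 0] can be taken to be 0, every transform being 1 there.

    Nothing says that the transforms of the tails approach 1 on these frequencies, so Parseval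
    cannot be passed to the limit; an inequality with the loss [1 / e] takes its place, and suffices
    because that constant is the same for all [phi]. Dividing by the transform of the tail is exact
    only if [phi (x + Q y)] is replaced by [phi x], [x] being an atom of [mu_n]. The error is
    controlled by the integral of [min 1 (eta |y|)] against the tail. This function is bounded and
    continuous, so weak convergence makes its integrals uniformly small; it also gives the
    equicontinuity of the transforms. *)

Local Notation Re := complex.Re.
Local Notation Im := complex.Im.

(** * Squared moduli, characters and the integer lattice *)

Section ComplexExp.
Variables (R : realType) (d : nat).
Notation vec := 'cV[R]_d.
Implicit Types (z w : R[i]) (t : R) (x y l k : vec).

Definition nsq z : R := Re z ^+ 2 + Im z ^+ 2.

Lemma nsq_ge0 z : 0 <= nsq z.
Proof. by rewrite addr_ge0 ?sqr_ge0. Qed.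

Lemma nsqM z w : nsq (z * w) = nsq z * nsq w.
Proof. by case: z => a b; case: w => p q; rewrite /nsq /=; ring. Qed.

Lemma nsqE z : Complex (nsq z) 0 = z * conjc z.
Proof.
case: z => a b; apply/eqP; rewrite eq_complex /nsq /=.
by apply/andP; split; apply/eqP; ring.
Qed.

Lemma nsq_eq0 z : (nsq z == 0) = (z == 0).
Proof.
by case: z => a b; rewrite /nsq paddr_eq0 ?sqr_ge0 // !sqrf_eq0 eq_complex.
Qed.

Lemma nsq_conjc z : nsq (conjc z) = nsq z.
Proof. by case: z => a b; rewrite /nsq /= sqrrN. Qed.

Lemma nsqV z : nsq z^-1 = (nsq z)^-1.
Proof.
have [->|z0] := eqVneq z 0.
  by rewrite invr0 /nsq /= !expr0n /= addr0 invr0.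
have nz : nsq z != 0 by rewrite nsq_eq0.
apply: (mulfI nz); rewrite divff // -nsqM divff // /nsq /=.
by rewrite expr1n expr0n addr0.
Qed.

Lemma ReM z w : Re (z * w) = Re z * Re w - Im z * Im w.
Proof. by case: z; case: w. Qed.

Lemma ImM z w : Im (z * w) = Re z * Im w + Im z * Re w.
Proof. by case: z; case: w. Qed.

Lemma ReD z w : Re (z + w) = Re z + Re w.
Proof. by case: z; case: w. Qed.

Lemma ImD z w : Im (z + w) = Im z + Im w.
Proof. by case: z; case: w. Qed.

Lemma Re_sum (I : Type) (r : seq I) (F : I -> R[i]) :
  Re (\sum_(i <- r) F i) = \sum_(i <- r) Re (F i).
Proof. by elim: r => [|a r IH]; rewrite ?big_nil // !big_cons ReD IH. Qed.

Lemma Im_sum (I : Type) (r : seq I) (F : I -> R[i]) :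
  Im (\sum_(i <- r) F i) = \sum_(i <- r) Im (F i).
Proof. by elim: r => [|a r IH]; rewrite ?big_nil // !big_cons ImD IH. Qed.

Lemma Complex_sum (I : Type) (r : seq I) (F : I -> R) :
  Complex (\sum_(i <- r) F i) 0 = \sum_(i <- r) Complex (F i) 0 :> R[i].
Proof. exact: (rmorph_sum (real_complex R)). Qed.

Lemma expiD t u : expi (t + u) = expi t * expi u :> R[i].
Proof.
rewrite /expi cosD sinD; apply/eqP; rewrite eq_complex /=.
by apply/andP; split; apply/eqP; ring.
Qed.

Lemma expi0 : expi 0 = 1 :> R[i].
Proof. by rewrite /expi cos0 sin0. Qed.

Lemma expiN t : expi (- t) = conjc (expi t) :> R[i].
Proof. by rewrite /expi cosN sinN. Qed.

Lemma nsq_expi t : nsq (expi t) = 1.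
Proof. by rewrite /nsq /= cos2Dsin2. Qed.

Lemma expi_2pi_int (m : int) : expi (2 * pi * m%:~R) = 1 :> R[i].
Proof.
have H (n : nat) : expi (2 * pi * n%:R) = 1 :> R[i].
  elim: n => [|n IH]; first by rewrite mulr0 expi0.
  have -> : 2 * pi * n.+1%:R = 2 * pi * n%:R + pi *+ 2 :> R.
    by rewrite -[n.+1]addn1 natrD -mulr_natl; ring.
  by rewrite expiD IH mul1r /expi cos2pi sin2pi.
case: m => n; first exact: H.
by rewrite NegzE mulrNz mulrN expiN H conjc1.
Qed.

(** The sign is that of the Fourier transform: the coefficient of [f] at [e_l] is the integral of
    [f] against [chi l]. *)
Definition chi l x : R[i] := expi (- (2 * pi * dotv l x)).

Lemma dotvC x y : dotv x y = dotv y x.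
Proof. by rewrite /dotv; apply: eq_bigr => i _; rewrite mulrC. Qed.

Lemma dotvDl x y (z : vec) : dotv (x + y) z = dotv x z + dotv y z.
Proof. by rewrite /dotv -big_split /=; apply: eq_bigr => i _; rewrite !mxE mulrDl. Qed.

Lemma dotvDr x y (z : vec) : dotv z (x + y) = dotv z x + dotv z y.
Proof. by rewrite dotvC dotvDl !(dotvC z). Qed.

Lemma dotvNl x y : dotv (- x) y = - dotv x y.
Proof. by rewrite /dotv -sumrN; apply: eq_bigr => i _; rewrite !mxE mulNr. Qed.

Lemma dotv0l x : dotv 0 x = 0.
Proof. by rewrite /dotv big1 // => i _; rewrite !mxE mul0r. Qed.

Lemma dotvE x y : dotv x y = (x^T *m y) 0 0.
Proof. by rewrite mxE; apply: eq_bigr => i _; rewrite !mxE. Qed.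

Lemma dotv_mull (M : 'M[R]_d) x y : dotv (M *m x) y = dotv x (M^T *m y).
Proof. by rewrite !dotvE trmx_mul mulmxA. Qed.

Lemma dotv_mulr (M : 'M[R]_d) x y : dotv x (M *m y) = dotv (M^T *m x) y.
Proof. by rewrite dotvC dotv_mull dotvC. Qed.

Lemma chiDl l k x : chi (l + k) x = chi l x * chi k x.
Proof. by rewrite /chi dotvDl mulrDr opprD expiD. Qed.

Lemma chiDr l x y : chi l (x + y) = chi l x * chi l y.
Proof. by rewrite /chi dotvDr mulrDr opprD expiD. Qed.

Lemma chi0l x : chi 0 x = 1.
Proof. by rewrite /chi dotv0l mulr0 oppr0 expi0. Qed.

Lemma chiN l x : chi (- l) x = conjc (chi l x).
Proof. by rewrite /chi dotvNl mulrN expiN. Qed.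

Lemma nsq_chi l x : nsq (chi l x) = 1.
Proof. exact: nsq_expi. Qed.

Lemma chi_mulr (M : 'M[R]_d) l x : chi l (M *m x) = chi (M^T *m l) x.
Proof. by rewrite /chi dotv_mulr. Qed.

Lemma chi_int l x : Zd l -> Zd x -> chi l x = 1.
Proof.
move=> [a ->] [b ->]; rewrite /chi /dotv.
rewrite (_ : \sum_i _ = (\sum_i (a i 0 * b i 0))%:~R).
  by rewrite -mulrN -mulrNz expi_2pi_int.
by rewrite rmorph_sum; apply: eq_bigr => i _; rewrite !mxE -intrM.
Qed.

Lemma intmx0 m n : intmx R (0 : 'M[int]_(m, n)) = 0.
Proof. by apply/matrixP => i j; rewrite !mxE. Qed.

Lemma intmxD m n (x y : 'M[int]_(m, n)) : intmx R (x + y) = intmx R x + intmx R y.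
Proof. by apply/matrixP => i j; rewrite !mxE intrD. Qed.

Lemma intmxN m n (x : 'M[int]_(m, n)) : intmx R (- x) = - intmx R x.
Proof. by apply/matrixP => i j; rewrite !mxE mulrNz. Qed.

Lemma intmxM m n p (x : 'M[int]_(m, n)) (y : 'M[int]_(n, p)) :
  intmx R (x *m y) = intmx R x *m intmx R y.
Proof.
apply/matrixP => i j; rewrite !mxE rmorph_sum; apply: eq_bigr => k _.
by rewrite !mxE -intrM.
Qed.

Lemma intmx_tr m n (x : 'M[int]_(m, n)) : (intmx R x)^T = intmx R x^T.
Proof. by apply/matrixP => i j; rewrite !mxE. Qed.

Lemma intmx_inj m n : injective (@intmx R m n).
Proof.
move=> x y /matrixP E; apply/matrixP => i j; have := E i j.
by rewrite !mxE => /intr_inj.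
Qed.

Lemma Zd0 : Zd (0 : vec).
Proof. by exists 0; rewrite intmx0. Qed.

Lemma ZdD x y : Zd x -> Zd y -> Zd (x + y).
Proof. by move=> [a ->] [b ->]; exists (a + b); rewrite intmxD. Qed.

Lemma ZdN x : Zd x -> Zd (- x).
Proof. by move=> [a ->]; exists (- a); rewrite intmxN. Qed.

Lemma Zd_mul (M : 'M[int]_d) x : Zd x -> Zd (intmx R M *m x).
Proof. by move=> [a ->]; exists (M *m a); rewrite intmxM. Qed.

End ComplexExp.

(** * Spectra of finitely supported measures *)

Section FiniteSpectrum.
Variables (R : realType) (d : nat).
Notation vec := 'cV[R]_d.
Implicit Types (s La : seq vec).

(* [s] lists the (equally weighted) atoms of a finitely supported measure. *)
Definition finspec s La : Prop :=
  [/\ uniq La,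
      forall l k, l \in La -> k \in La -> l != k ->
        \sum_(x <- s) chi (l - k) x = 0 &
      forall phi : vec -> R[i],
        \sum_(l <- La) nsq (\sum_(x <- s) phi x * chi l x) =
        (size s)%:R * \sum_(x <- s) nsq (phi x)].

Lemma sum_const1_neq0 s : s != [::] -> \sum_(x <- s) (1 : R[i]) != 0.
Proof. by case: s => // a s _; rewrite big_const_seq count_predT iter_addr_0 pnatr_eq0. Qed.

Lemma finspec_translate s La (l0 : vec) :
  finspec s La -> finspec s [seq l - l0 | l <- La].
Proof.
case=> U O P; split.
- by rewrite map_inj_uniq // => x y /addIr.
- move=> l k /mapP[l' l'L ->] /mapP[k' k'L ->].
  by rewrite opprB addrA subrK => ne; apply: O => //; apply: contraNneq ne => ->.
- move=> phi; rewrite big_map.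
  under eq_bigr => l _ do under eq_bigr => x _ do rewrite chiDl mulrA mulrAC.
  rewrite (P (fun x => phi x * chi (- l0) x)); congr (_ * _).
  by apply: eq_bigr => x _; rewrite nsqM nsq_chi mulr1.
Qed.

(** Only the values of the characters on the atoms matter, so each frequency may be moved by its own
    [f l]. This freedom is what later allows a good integer translate to be chosen for each
    frequency separately. *)
Lemma finspec_shift s La (f : vec -> vec) : s != [::] ->
  (forall l x, l \in La -> x \in s -> chi (f l) x = 1) ->
  finspec s La -> finspec s [seq l + f l | l <- La].
Proof.
move=> s0 f1 [U O P].
have E l k : l \in La -> k \in La ->
    \sum_(x <- s) chi (l + f l - (k + f k)) x = \sum_(x <- s) chi (l - k) x.
  move=> lL kL; rewrite !big_seq; apply: eq_bigr => x xs.
  have -> : l + f l - (k + f k) = (l - k) + (f l - f k) by rewrite opprD addrACA.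
  by rewrite (chiDl (l - k)) (chiDl (f l)) chiN !f1 // conjc1 !mulr1.
split.
(* If two shifted frequencies coincided, the vanishing sum for [l - k] would be a sum of ones over
   the nonempty list [s]. *)
- rewrite map_inj_in_uniq // => l k lL kL e; apply/eqP; apply: contraT => ne.
  have := O l k lL kL ne; rewrite -E // e subrr => /eqP.
  under eq_bigr => x _ do rewrite chi0l.
  by rewrite (negPf (sum_const1_neq0 s0)).
- move=> l k /mapP[l' l'L ->] /mapP[k' k'L ->] ne; rewrite E //.
  by apply: O => //; apply: contraNneq ne => ->.
- move=> phi; rewrite big_map -P !big_seq; apply: eq_bigr => l lL; congr nsq.
  by rewrite !big_seq; apply: eq_bigr => x xs; rewrite chiDl f1 // mulr1.
Qed.

(** The frequency [P^T l'] is invisible on [s], where [P x] is integral, and acts on the contracted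
    copy of [s'] as [l'] acts on [s']. Exponential sums therefore split into an [s] factor and an
    [s'] factor. *)
Lemma finspec_prod s La s' La' (P : 'M[R]_d) : s != [::] -> s' != [::] ->
  P \in unitmx ->
  (forall x, x \in s -> Zd (P *m x)) -> (forall l, l \in La' -> Zd l) ->
  finspec s La -> finspec s' La' ->
  finspec [seq x + invmx P *m y | x <- s, y <- s']
          [seq l + P^T *m l' | l <- La, l' <- La'].
Proof.
move=> s0 s0' uP Ps iL' [U O Pa] [U' O' Pa'].
have X1 x l' : x \in s -> l' \in La' -> chi (P^T *m l') x = 1.
  by move=> xs l'L; rewrite -chi_mulr chi_int //; [exact: iL'|exact: Ps].
have Y1 l' y : chi (P^T *m l') (invmx P *m y) = chi l' y.
  by rewrite -chi_mulr mulmxA mulmxV // mul1mx.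
have E l k l' k' : l' \in La' -> k' \in La' ->
    \sum_(x <- s) \sum_(y <- s')
       chi (l + P^T *m l' - (k + P^T *m k')) (x + invmx P *m y) =
    (\sum_(x <- s) chi (l - k) x) *
    (\sum_(y <- s') chi (l - k) (invmx P *m y) * chi (l' - k') y).
  move=> l'L k'L; rewrite mulr_suml big_seq [RHS]big_seq; apply: eq_bigr => x xs.
  rewrite mulr_sumr; apply: eq_bigr => y _.
  rewrite opprD addrACA -mulmxBr chiDr !chiDl Y1 mulmxBr !chiDl !chiN !X1 //.
  by rewrite conjc1 !mulr1 !mulrA.
have O2 l k l' k' : l \in La -> k \in La -> l' \in La' -> k' \in La' ->
    (l, l') != (k, k') ->
    \sum_(x <- s) \sum_(y <- s')
       chi (l + P^T *m l' - (k + P^T *m k')) (x + invmx P *m y) = 0.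
  move=> lL kL l'L k'L ne; rewrite E //.
  (* Different first components kill the [s] factor; equal ones leave the plain sum for [l' - k']
     over [s']. *)
  have [elk|nlk] := eqVneq l k; last by rewrite O // mul0r.
  have ne' : l' != k' by apply: contraNneq ne => ->; rewrite elk.
  rewrite elk subrr; under [X in _ * X]eq_bigr => y _ do rewrite chi0l mul1r.
  by rewrite O' // mulr0.
split.
- apply: allpairs_uniq => // -[l l'] [k k'] /allpairsP[[a b] /= [aL bL [-> ->]]].
  move=> /allpairsP[[a' b'] /= [a'L b'L [-> ->]]] e.
  apply/eqP; apply: contraT => ne; have := O2 _ _ _ _ aL a'L bL b'L ne.
  rewrite e subrr.
  under eq_bigr => x _ do under eq_bigr => y _ do rewrite chi0l.
  under eq_bigr => x _ do rewrite -[\sum_(y <- s') 1]mul1r.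
  rewrite -mulr_suml => /eqP; rewrite mulf_eq0.
  by rewrite (negPf (sum_const1_neq0 s0)) (negPf (sum_const1_neq0 s0')).
- move=> l k /allpairsP[[a b] /= [aL bL ->]] /allpairsP[[a' b'] /= [a'L b'L ->]] ne.
  rewrite big_allpairs_dep /=; apply: O2 => //.
  by apply: contraNneq ne => -[-> ->].
- move=> phi.
  (* Parseval is used twice: over [s'] for each fixed [l], then over [s] for each fixed [y], the
     unimodular factor [chi l (invmx P *m y)] dropping out of the squared modulus in between. *)
  transitivity (\sum_(l <- La) \sum_(l' <- La') nsq (\sum_(y <- s')
      ((\sum_(x <- s) phi (x + invmx P *m y) * chi l x) * chi l (invmx P *m y))
       * chi l' y)).
    rewrite big_allpairs_dep /= big_seq [RHS]big_seq; apply: eq_bigr => l lL.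
    rewrite big_seq [RHS]big_seq; apply: eq_bigr => l' l'L.
    rewrite big_allpairs_dep exchange_big /=; congr nsq; apply: eq_bigr => y _.
    rewrite -mulrA mulr_suml big_seq [RHS]big_seq; apply: eq_bigr => x xs.
    by rewrite chiDl !chiDr X1 // Y1 mul1r -!mulrA.
  under eq_bigr => l _ do rewrite (Pa' (fun y =>
    (\sum_(x <- s) phi (x + invmx P *m y) * chi l x) * chi l (invmx P *m y))).
  rewrite -mulr_sumr exchange_big /=.
  under eq_bigr => y _ do under eq_bigr => l _ do rewrite nsqM nsq_chi mulr1.
  under eq_bigr => y _ do rewrite (Pa (fun x => phi (x + invmx P *m y))).
  rewrite -mulr_sumr mulrA size_allpairs -natrM mulnC; congr (_ * _).
  by rewrite big_allpairs_dep /= exchange_big.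
Qed.

End FiniteSpectrum.

(** * Admissible pairs and the atoms of the finite convolutions *)

Section Admissible.
Variables (R : realType) (d : nat).
Notation vec := 'cV[R]_d.

(** A singular matrix has the eigenvalue 0, which expansion excludes. *)
Lemma expanding_unit (M : 'M[int]_d) : expanding R M -> intmx R M \in unitmx.
Proof.
move=> eM; rewrite unitmxE unitfE; apply/negP => /eqP D0.
have M0 : \det M = 0.
  apply/eqP; rewrite -(@intr_eq0 R); apply/eqP.
  by rewrite -[RHS]D0 -(det_map_mx (intmul (1 : R))).
suff : (1 : R[i]) < `|0 : R[i]| by rewrite normr0 ltr10.
apply: eM; rewrite /root horner_coef0 char_poly_det.
by rewrite -/(map_mx (intmul (1 : R[i])) M) det_map_mx M0 rmorph0 mulr0.
Qed.

Lemma big_map_ord (T I : Type) (S : nmodType) (x0 : I) (f : I -> T) (s : seq I)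
    (n : nat) (F : T -> S) : size s = n ->
  \sum_(x <- [seq f b | b <- s]) F x = \sum_(i < n) F (f (nth x0 s i)).
Proof. by move=> <-; rewrite big_map (big_nth x0) big_mkord. Qed.

(** The two forms of unitarity share the work: [U U^* = 1] says that [v U] has the norm of [v],
    which is Parseval, and [U^* U = 1] is the orthogonality of the frequencies. Translating by one
    element of the integral spectrum puts 0 into it. *)
Lemma admissible_finspec (M : 'M[int]_d) (B : seq 'cV[int]_d) :
  admissible R M B -> B != [::] ->
  exists L : seq vec, [/\ 0 \in L, forall l, l \in L -> Zd l &
    finspec [seq invmx (intmx R M) *m intmx R b | b <- B] L].
Proof.
move=> [eM [uB [L [uL [sL UU]]]]] B0.
suff F : finspec [seq invmx (intmx R M) *m intmx R b | b <- B] [seq intmx R l | l <- L].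
  have [l0 l0L] : exists l0, l0 \in L.
    case: (L) sL => [/eqP|l0 ? _]; first by rewrite eq_sym size_eq0 (negPf B0).
    by exists l0; rewrite mem_head.
  exists [seq l - intmx R l0 | l <- [seq intmx R l | l <- L]]; split.
  - by rewrite -(subrr (intmx R l0)); apply: map_f; apply: map_f.
  - move=> l /mapP[k /mapP[k' _ ->] ->]; exists (k' - l0).
    by rewrite intmxD intmxN.
  - exact: finspec_translate.
set n := size B in sL UU *.
have n0 : (n%:R : R) != 0 by rewrite pnatr_eq0 size_eq0.
set U := \matrix_(i, j) _ in UU.
pose c : R[i] := Complex (Num.sqrt (n%:R : R))^-1 0.
pose x (i : 'I_n) : vec := invmx (intmx R M) *m intmx R (nth 0 B i).
pose la (i : 'I_n) : vec := intmx R (nth 0 L i).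
have UE i j : U i j = c * chi (la j) (x i) by rewrite mxE /chi dotvC.
have nc : nsq c = n%:R^-1 by rewrite /nsq /= expr0n addr0 exprVn sqr_sqrtr // ler0n.
have c0 : c != 0 by rewrite -nsq_eq0 nc invr_eq0.
have VV := mulmx1C UU.
split.
- by rewrite map_inj_uniq //; exact: intmx_inj.
- move=> l k /mapP[l' l'L ->] /mapP[k' k'L ->] ne.
  have lt1 : (index l' L < n)%N by rewrite -sL index_mem.
  have lt2 : (index k' L < n)%N by rewrite -sL index_mem.
  pose i := Ordinal lt1; pose j := Ordinal lt2.
  have [li kj] : intmx R l' = la i /\ intmx R k' = la j by rewrite /la /= !nth_index.
  have ij : i != j.
    by apply: contraNneq ne => e; rewrite li kj e.
  have := VV => /matrixP /(_ j i); rewrite !mxE eq_sym (negPf ij) => E.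
  rewrite (big_map_ord 0 _ _ (erefl n)) li kj.
  apply: (mulfI (_ : c * conjc c != 0)).
    by rewrite mulf_neq0 // conjc_eq0.
  rewrite mulr0 -[RHS]E mulr_sumr; apply: eq_bigr => a _.
  rewrite [(_^T) j a]mxE [(map_mx _ U) a j]mxE !UE rmorphM chiDl chiN -/(x a).
  by ring.
- move=> phi.
  rewrite (big_map_ord 0 _ _ sL) size_map -/n.
  under eq_bigr => j _ do rewrite (big_map_ord 0 _ _ (erefl n)).
  rewrite (big_map_ord 0 _ _ (erefl n)).
  pose v : 'rV[R[i]]_n := \row_i phi (x i).
  have E : (v *m U) *m (map_mx (@conjc R) (v *m U))^T = v *m (map_mx (@conjc R) v)^T.
    by rewrite map_mxM trmx_mul mulmxA -(mulmxA v) UU mulmx1.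
  have {E} : Complex (\sum_(j < n) nsq ((v *m U) 0 j)) 0 =
      Complex (\sum_(i < n) nsq (v 0 i)) 0 :> R[i].
    rewrite !Complex_sum; move/matrixP: E => /(_ 0 0); rewrite 2!mxE => E.
    transitivity (\sum_j (v *m U) 0 j * ((map_mx (@conjc R) (v *m U))^T) j 0).
      by apply: eq_bigr => j _; rewrite nsqE !mxE.
    by rewrite E; apply: eq_bigr => j _; rewrite nsqE !mxE.
  case=> E.
  transitivity (n%:R * \sum_(j < n) nsq ((v *m U) 0 j)); last first.
    by rewrite E; congr (_ * _); apply: eq_bigr => i _; rewrite mxE.
  rewrite mulr_sumr; apply: eq_bigr => j _; rewrite mxE.
  under [in RHS]eq_bigr => i _ do rewrite UE mxE mulrCA.
  by rewrite -mulr_sumr nsqM nc mulVKf.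
Qed.

Variables (Rs : nat -> 'M[int]_d) (Bs : nat -> seq 'cV[int]_d).
Hypothesis adm : forall n, admissible R (Rs n) (Bs n).

Local Notation prodR := (prodR R Rs).
Local Notation convpts := (convpts R Rs Bs).
Local Notation digits := (digits R Rs Bs).

Lemma Rs_unit n : intmx R (Rs n) \in unitmx.
Proof. by apply: expanding_unit; have [] := adm n. Qed.

Lemma prodR_unit m k : prodR m k \in unitmx.
Proof. by elim: k => [|k IH] /=; rewrite ?unitmx1 // unitmx_mul Rs_unit. Qed.

Lemma prodR_add m n k : prodR m (n + k) = prodR (m + n) k *m prodR m n.
Proof.
elim: k => [|k IH]; first by rewrite addn0 /= mul1mx.
by rewrite addnS /= IH addnA mulmxA.
Qed.

Lemma mulmx1_invmx (A B : 'M[R]_d) : A *m B = 1%:M -> A = invmx B.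
Proof.
move=> AB; have [_ uB] := mulmx1_unit AB.
by rewrite -[A]mulmx1 -(mulmxV uB) mulmxA AB mul1mx.
Qed.

Lemma invmx_mul (A B : 'M[R]_d) : A \in unitmx -> B \in unitmx ->
  invmx (A *m B) = invmx B *m invmx A.
Proof.
move=> uA uB; symmetry; apply: mulmx1_invmx.
by rewrite -mulmxA (mulmxA (invmx A)) mulVmx // mul1mx mulVmx.
Qed.

Lemma invprodE n : invprod R Rs n = invmx (prodR 0 n).
Proof.
elim: n => [|n IH] /=; first by rewrite invmx1.
by rewrite add0n invmx_mul ?Rs_unit ?prodR_unit // IH.
Qed.

Lemma Zd_prodR_tr m k (x : vec) : Zd x -> Zd ((prodR m k)^T *m x).
Proof.
elim: k x => [|k IH] x Zx /=; first by rewrite trmx1 mul1mx.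
by rewrite trmx_mul -mulmxA intmx_tr; apply: IH; exact: Zd_mul.
Qed.

Lemma digitsS m k : digits m k.+1 =
  [seq invmx (prodR m k) *m y |
    y <- [seq invmx (intmx R (Rs (m + k))) *m intmx R b | b <- Bs (m + k)]].
Proof.
rewrite /digits /= -map_comp; apply: eq_map => b /=.
by rewrite invmx_mul ?Rs_unit ?prodR_unit // mulmxA.
Qed.

Lemma digits_shift m n k : digits m (n + k).+1 =
  [seq invmx (prodR m n) *m y | y <- digits (m + n) k.+1].
Proof.
rewrite /digits -map_comp addnA; apply: eq_map => b /=.
rewrite mulmxA; congr (_ *m _).
rewrite prodR_add !invmx_mul ?unitmx_mul ?Rs_unit ?prodR_unit //.
by rewrite addnA !mulmxA.
Qed.

Lemma allpairs_assoc (X Y W Z V T : Type) (s : seq X) (t : seq Y) (u : seq W)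
    (f : X -> Y -> Z) (g : Z -> W -> T) (k : Y -> W -> V) (h : X -> V -> T) :
  (forall x y w, g (f x y) w = h x (k y w)) ->
  [seq g z w | z <- [seq f x y | x <- s, y <- t], w <- u] =
  [seq h x v | x <- s, v <- [seq k y w | y <- t, w <- u]].
Proof.
move=> E; elim: s => //= x s IH.
rewrite allpairs_cat IH; congr (_ ++ _).
elim: t {IH} => //= y t IH; rewrite map_cat IH; congr (_ ++ _).
by rewrite -map_comp; apply: eq_map => w /=; rewrite E.
Qed.

(** Discrete form of the splitting of [mu] into [mu_n] and a contracted tail: all digit sets after
    the first [n] carry the common factor [invmx (prodR m n)]. It is an equality of lists, so
    multiplicities are respected. *)
Lemma convpts_cat m n k : convpts m (n + k) =
  [seq x + invmx (prodR m n) *m y | x <- convpts m n, y <- convpts (m + n) k].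
Proof.
elim: k => [|k IH].
  rewrite addn0 /=; elim: (convpts m n) => //= x s {1}->.
  by rewrite mulmx0 addr0.
rewrite addnS [LHS]/= IH digits_shift /= allpairs_mapr.
by apply: allpairs_assoc => x y w; rewrite mulmxDr addrA.
Qed.

(** Multiplying by the full product clears the denominators of every digit. Hence [(prodR m k)^T]
    maps integer vectors to frequencies whose characters are 1 on these atoms. *)
Lemma convpts_int m k (x : vec) : x \in convpts m k -> Zd (prodR m k *m x).
Proof.
elim: k x => [|k IH] x /=.
  by rewrite inE => /eqP ->; rewrite mulmx0; exact: Zd0.
rewrite digitsS => /allpairsP[[a b] /= [aC /mapP[c /mapP[e _ ->] ->] ->]].
rewrite mulmxDr -mulmxA; apply: ZdD; first by apply: Zd_mul; exact: IH.
rewrite !mulmxA -(mulmxA (intmx R _)) mulmxV ?prodR_unit // mulmx1.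
by rewrite mulmxV ?Rs_unit // mul1mx; exists e.
Qed.

Hypothesis Bs0 : forall n, Bs n != [::].

Lemma convpts_neq0 m k : convpts m k != [::].
Proof.
elim: k => //= k IH; rewrite -size_eq0 size_allpairs muln_eq0 !size_eq0.
by rewrite negb_or IH -size_eq0 size_map size_eq0 Bs0.
Qed.

(** Iterating the product construction yields the frequencies [l_1 + R_{m+1}^T l_2 + (R_{m+2}
    R_{m+1})^T l_3 + ...], starting from a unit mass at 0 with the single frequency 0. *)
Lemma convpts_finspec m k : exists L : seq vec,
  [/\ 0 \in L, forall l, l \in L -> Zd l & finspec (convpts m k) L].
Proof.
elim: k => [|k [L [L0 ZL FL]]].
  exists [:: 0]; split=> [|l|]; first by rewrite mem_head.
    by rewrite inE => /eqP ->; exact: Zd0.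
  split=> // [l k|phi].
    by rewrite !inE => /eqP -> /eqP ->; rewrite eqxx.
  by rewrite !big_seq1 chi0l mulr1 mul1r.
have [L' [L0' ZL' FL']] := admissible_finspec (adm (m + k)) (Bs0 (m + k)).
exists [seq l + (prodR m k)^T *m l' | l <- L, l' <- L']; split.
- apply/allpairsP; exists (0, 0); split=> //=.
  by rewrite mulmx0 addr0.
- move=> l /allpairsP[[a b] /= [aL bL ->]]; apply: ZdD; first exact: ZL.
  by apply: Zd_prodR_tr; exact: ZL'.
- rewrite /= digitsS allpairs_mapr; apply: finspec_prod => //.
  + exact: convpts_neq0.
  + by rewrite -size_eq0 size_map size_eq0.
  + exact: prodR_unit.
  + by move=> x; exact: convpts_int.
Qed.

End Admissible.

(** * The max norm on matrices and the continuity of linear maps *)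

Section MaxNorm.
Variables (R : realType).

Lemma entry_le_norm m n (M : 'M[R]_(m, n)) i j : `|M i j| <= `|M|.
Proof.
rewrite [leRHS]/Num.norm /= mx_normrE.
by apply/bigmax_geP; right => /=; exists (i, j).
Qed.

Lemma norm_le_entry m n (M : 'M[R]_(m, n)) (c : R) : 0 <= c ->
  (forall i j, `|M i j| <= c) -> `|M| <= c.
Proof.
move=> c0 H; rewrite [leLHS]/Num.norm /= mx_normrE.
by apply/bigmax_leP; split => // -[i j] _; exact: H.
Qed.

Lemma norm_trmx m n (M : 'M[R]_(m, n)) : `|M^T| = `|M|.
Proof.
apply/eqP; rewrite eq_le; apply/andP; split; apply: norm_le_entry => // i j.
  by rewrite mxE entry_le_norm.
by rewrite -[M]trmxK [M^T^T i j]mxE trmxK entry_le_norm.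
Qed.

(** The norm is the largest entry, which is not submultiplicative; the inner dimension makes up for
    it and is the origin of the factors [d] in later estimates. *)
Lemma norm_mulmx m n p (M : 'M[R]_(m, n)) (N : 'M[R]_(n, p)) :
  `|M *m N| <= n%:R * `|M| * `|N|.
Proof.
apply: norm_le_entry => [|i j]; first by rewrite !mulr_ge0 ?ler0n.
rewrite mxE (le_trans (ler_norm_sum _ _ _)) //.
apply: (@le_trans _ _ (\sum_(k < n) `|M| * `|N|)).
  by apply: ler_sum => k _; rewrite normrM ler_pM ?entry_le_norm.
by rewrite big_const_ord iter_addr_0 -(mulr_natl (`|M| * `|N|)) mulrA.
Qed.

Lemma norm_dotv d (x y : 'cV[R]_d) : `|dotv x y| <= d%:R * `|x| * `|y|.
Proof.
rewrite dotvE -(norm_trmx x); apply: le_trans (norm_mulmx _ _).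
exact: entry_le_norm.
Qed.

Lemma lipschitz_continuous_norm (V W : normedModType R) (f : V -> W) (K : R) :
  (forall x y, `|f x - f y| <= K * `|x - y|) -> continuous f.
Proof.
move=> H x; apply/cvgrPdist_lt => e e0.
have K1 : 0 < `|K| + 1 by rewrite ltr_wpDl.
apply/nbhs_ballP; exists (e / (`|K| + 1)) => /=; first by rewrite divr_gt0.
move=> y; rewrite -ball_normE /= ltr_pdivlMr // mulrC => xy.
rewrite (le_lt_trans (H _ _)) // (le_lt_trans _ xy) //.
by rewrite ler_wpM2r // (le_trans (ler_norm K)) // lerDl.
Qed.

Lemma mulmx_continuous m n p (M : 'M[R]_(m, n)) :
  continuous (fun x : 'M[R]_(n, p) => M *m x).
Proof.
apply: (@lipschitz_continuous_norm _ _ _ (n%:R * `|M|)) => x y.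
by rewrite -mulmxBr; exact: norm_mulmx.
Qed.

Lemma dotv_continuous d (l : 'cV[R]_d) : continuous (fun x : 'cV[R]_d => dotv l x).
Proof.
apply: (@lipschitz_continuous_norm _ _ _ (d%:R * `|l|)) => x y.
by rewrite dotvC (dotvC l y) -dotvNl -dotvDl dotvC; exact: norm_dotv.
Qed.

End MaxNorm.

(** * Bounded continuous functions and their integrals *)

Section BoundedContinuous.
Variables (R : realType) (d : nat).
Notation vec := 'cV[R]_d.
Notation bc := (@bounded_continuous R d).
Implicit Types (f g : vec -> R).

Lemma bc_cst (c : R) : bc (fun=> c).
Proof. by split; [exact: cst_continuous | exists `|c|]. Qed.

Lemma bc_add f g : bc f -> bc g -> bc (fun x => f x + g x).
Proof.
move=> [cf [M fM]] [cg [N gN]]; split.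
  by move=> x; exact: (continuousD (cf x) (cg x)).
by exists (M + N) => x; rewrite (le_trans (ler_normD _ _)) // lerD.
Qed.

Lemma bc_mul f g : bc f -> bc g -> bc (fun x => f x * g x).
Proof.
move=> [cf [M fM]] [cg [N gN]]; split.
  by move=> x; exact: (continuousM (cf x) (cg x)).
by exists (M * N) => x; rewrite normrM ler_pM.
Qed.

Lemma bc_opp f : bc f -> bc (fun x => - f x).
Proof.
move=> [cf [M fM]]; split; first by move=> x; exact: (continuousN (cf x)).
by exists M => x; rewrite normrN.
Qed.

Lemma bc_sub f g : bc f -> bc g -> bc (fun x => f x - g x).
Proof. by move=> bf bg; apply: bc_add => //; exact: bc_opp. Qed.

Lemma bc_affine f (x : vec) (M : 'M[R]_d) : bc f -> bc (fun y => f (x + M *m y)).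
Proof.
move=> [cf [N fN]]; split; last by exists N => y.
move=> y; apply: (@continuous_comp _ _ _ (fun y => x + M *m y) f); last exact: cf.
by apply: continuousD; [exact: cst_continuous|exact: mulmx_continuous].
Qed.

Lemma bc_cos (l : vec) : bc (fun x => cos (2 * pi * dotv l x)).
Proof.
split; last by exists 1 => x; rewrite ler_norml cos_geN1 cos_le1.
move=> x; apply: (@continuous_comp _ _ _ (fun x => 2 * pi * dotv l x) cos).
  by apply: continuousM; [exact: cst_continuous|exact: dotv_continuous].
exact: continuous_cos.
Qed.

Lemma bc_sin (l : vec) : bc (fun x => sin (2 * pi * dotv l x)).
Proof.
split; last by exists 1 => x; rewrite ler_norml sin_geN1 sin_le1.
move=> x; apply: (@continuous_comp _ _ _ (fun x => 2 * pi * dotv l x) sin).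
  by apply: continuousM; [exact: cst_continuous|exact: dotv_continuous].
exact: continuous_sin.
Qed.

Lemma continuous_measurable_Rd f : continuous f ->
  measurable_fun (setT : set (Rd R d)) f.
Proof.
move=> /continuousP cf; apply: (measurability _ (RGenOpens.measurableE R)).
move=> _ [_ [a [b ->]] <-]; rewrite setTI; apply: sub_sigma_algebra.
by apply: cf; exact: interval_open.
Qed.

Variable P : probability (Rd R d) R.

Lemma bounded_integrable (f : Rd R d -> R) (M : R) : measurable_fun setT f ->
  (forall x, `|f x| <= M) -> P.-integrable setT (EFin \o f).
Proof.
move=> mf fM; apply: measurable_bounded_integrable => //.
  by rewrite [X in (X < _)%E](_ : _ = 1%E) ?ltry //; exact: probability_setT.
exists M; split; first exact: num_real.
by move=> N MN x _; apply: (le_trans (fM x)); exact: ltW.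
Qed.

Lemma bc_measurable f : bc f -> measurable_fun (setT : set (Rd R d)) f.
Proof. by move=> [cf _]; exact: continuous_measurable_Rd. Qed.

Lemma bc_integrable f : bc f -> P.-integrable setT (EFin \o f).
Proof.
move=> bf; have [_ [M fM]] := bf; apply: bounded_integrable fM.
exact: bc_measurable.
Qed.

Local Notation I f := (Rintegral P setT f).

Lemma Rint_cst (c : R) : I (fun=> c) = c.
Proof.
by rewrite Rintegral_cst // [X in fine X](_ : _ = 1%E) ?mulr1 //; exact: probability_setT.
Qed.

Lemma Rint_add f g : bc f -> bc g -> I (fun x => f x + g x) = I f + I g.
Proof. by move=> bf bg; apply: RintegralD => //; exact: bc_integrable. Qed.

Lemma Rint_scale (c : R) f : bc f -> I (fun x => c * f x) = c * I f.
Proof. by move=> bf; apply: RintegralZl => //; exact: bc_integrable. Qed.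

Lemma Rint_sub f g : bc f -> bc g -> I (fun x => f x - g x) = I f - I g.
Proof. by move=> bf bg; apply: RintegralB => //; exact: bc_integrable. Qed.

Lemma Rint_le f g : bc f -> bc g -> (forall x, f x <= g x) -> I f <= I g.
Proof. by move=> bf bg fg; apply: le_Rintegral => //; exact: bc_integrable. Qed.

End BoundedContinuous.

(** * Complex-valued integrals and the Fourier transform *)

Section ComplexIntegral.
Variables (R : realType) (d : nat).
Notation vec := 'cV[R]_d.
Notation bc := (@bounded_continuous R d).
Implicit Types (f g : vec -> R[i]).

Definition cbc f := bc (fun x => Re (f x)) /\ bc (fun x => Im (f x)).

Lemma cbc_cst (c : R[i]) : cbc (fun=> c).
Proof. by split; exact: bc_cst. Qed.

Lemma cbc_add f g : cbc f -> cbc g -> cbc (fun x => f x + g x).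
Proof.
by move=> [? ?] [? ?]; split; [under eq_fun do rewrite ReD|under eq_fun do rewrite ImD];
  exact: bc_add.
Qed.

Lemma cbc_mul f g : cbc f -> cbc g -> cbc (fun x => f x * g x).
Proof.
move=> [? ?] [? ?]; split.
  by under eq_fun do rewrite ReM; apply: bc_sub; exact: bc_mul.
by under eq_fun do rewrite ImM; apply: bc_add; exact: bc_mul.
Qed.

Lemma cbc_sum (I : Type) (r : seq I) (F : I -> vec -> R[i]) :
  (forall i, cbc (F i)) -> cbc (fun x => \sum_(i <- r) F i x).
Proof.
move=> H; elim: r => [|a r IH].
  by under eq_fun do rewrite big_nil; exact: cbc_cst.
by under eq_fun do rewrite big_cons; exact: cbc_add.
Qed.

Lemma cbc_affine f (x : vec) (M : 'M[R]_d) : cbc f -> cbc (fun y => f (x + M *m y)).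
Proof. by move=> [bR bI]; split; [exact: (bc_affine x M bR)|exact: (bc_affine x M bI)]. Qed.

Lemma cbc_chi (l : vec) : cbc (chi l).
Proof.
split.
  by rewrite /chi /=; under eq_fun do rewrite cosN; exact: bc_cos.
by rewrite /chi /=; under eq_fun do rewrite sinN; apply: bc_opp; exact: bc_sin.
Qed.

Lemma bc_nsq f : cbc f -> bc (fun x => nsq (f x)).
Proof. by move=> [bR bI]; apply: bc_add; exact: bc_mul. Qed.

Variable P : probability (Rd R d) R.

Definition cint f : R[i] :=
  Complex (Rintegral P setT (fun x => Re (f x))) (Rintegral P setT (fun x => Im (f x))).

Lemma cint_add f g : cbc f -> cbc g -> cint (fun x => f x + g x) = cint f + cint g.
Proof.
move=> [? ?] [? ?]; rewrite /cint.
under [in LHS]eq_fun do rewrite ReD.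
under [X in Complex _ (Rintegral _ _ X)]eq_fun do rewrite ImD.
by rewrite !Rint_add.
Qed.

Lemma cint_scale (c : R[i]) f : cbc f -> cint (fun x => c * f x) = c * cint f.
Proof.
move=> [? ?]; rewrite /cint.
under [in LHS]eq_fun do rewrite ReM.
under [X in Complex _ (Rintegral _ _ X)]eq_fun do rewrite ImM.
have H (r : R) (h : vec -> R) : bc h -> bc (fun x => r * h x).
  by move=> bh; apply: bc_mul => //; exact: bc_cst.
rewrite Rint_sub ?Rint_add ?Rint_scale //; try exact: H.
by case: c.
Qed.

Lemma cint_sum (J : Type) (r : seq J) (F : J -> vec -> R[i]) :
  (forall i, cbc (F i)) -> cint (fun x => \sum_(i <- r) F i x) = \sum_(i <- r) cint (F i).
Proof.
move=> H; elim: r => [|a r IH].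
  under [in LHS]eq_fun do rewrite big_nil.
  by rewrite big_nil /cint !Rint_cst.
under [in LHS]eq_fun do rewrite big_cons.
by rewrite cint_add // ?IH ?big_cons //; exact: cbc_sum.
Qed.

Definition fhat (xi : vec) : R[i] := cint (chi xi).

Lemma fhatE (xi : vec) : fhat xi =
  Complex (Rintegral P setT (fun x => cos (2 * pi * dotv xi x)))
          (- Rintegral P setT (fun x => sin (2 * pi * dotv xi x))).
Proof.
rewrite /fhat /cint /chi /=.
under eq_fun do rewrite cosN.
under [X in Complex _ (Rintegral _ _ X)]eq_fun do rewrite sinN -mulN1r.
by rewrite Rint_scale ?mulN1r //; exact: bc_sin.
Qed.

Lemma fourier_zeroP (xi : vec) : fourier_zero P xi <-> fhat xi = 0.
Proof.
rewrite fhatE; split=> [[E1 E2]|[E1 /eqP]].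
  by apply/eqP; rewrite eq_complex /= oppr_eq0; apply/andP; split; apply/eqP.
by rewrite oppr_eq0 => /eqP.
Qed.

Lemma fhat0 : fhat 0 = 1.
Proof.
rewrite fhatE; under eq_fun do rewrite dotv0l mulr0 cos0.
under [X in Complex _ (- Rintegral _ _ X)]eq_fun do rewrite dotv0l mulr0 sin0.
by rewrite !Rint_cst oppr0.
Qed.

End ComplexIntegral.

(** * Density of bounded Lipschitz functions in [L^2(P)] *)

Section LipschitzDensity.
Variables (R : realType) (d : nat) (P : probability (Rd R d) R).
Notation vec := 'cV[R]_d.
Implicit Types (p q : vec -> R) (f g : Rd R d -> R).

Definition lipb p := exists M : R,
  (forall x, `|p x| <= M) /\ (forall x y, `|p x - p y| <= M * `|x - y|).

Lemma lipb_bc p : lipb p -> @bounded_continuous R d p.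
Proof.
move=> [M [pM pL]]; split; last by exists M.
exact: lipschitz_continuous_norm pL.
Qed.

Lemma lipb_cst (c : R) : lipb (fun=> c).
Proof. by exists `|c|; split=> // x y; rewrite subrr normr0 mulr_ge0. Qed.

Lemma lipb_add p q : lipb p -> lipb q -> lipb (fun x => p x + q x).
Proof.
move=> [M [pM pL]] [N [qN qL]]; exists (M + N); split=> [x|x y].
  by rewrite (le_trans (ler_normD _ _)) // lerD.
by rewrite opprD addrACA mulrDl (le_trans (ler_normD _ _)) // lerD.
Qed.

Lemma lipb_scale (c : R) p : lipb p -> lipb (fun x => c * p x).
Proof.
move=> [M [pM pL]]; exists (`|c| * M); split=> [x|x y].
  by rewrite normrM ler_wpM2l.
by rewrite -mulrBr normrM -mulrA ler_wpM2l.
Qed.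

Lemma dist_maxr (a b c e : R) :
  `|Num.max a b - Num.max c e| <= `|a - c| + `|b - e|.
Proof.
by rewrite /Num.max; do 2 case: ltP => ?;
  rewrite ler_norml; have := ler_norm (a - c); have := ler_norm (c - a);
  have := ler_norm (b - e); have := ler_norm (e - b);
  rewrite !(distrC c) !(distrC e) => *; apply/andP; split; lra.
Qed.

Lemma lipb_max p q : lipb p -> lipb q -> lipb (fun x => Num.max (p x) (q x)).
Proof.
move=> [M [pM pL]] [N [qN qL]]; exists (M + N); split=> [x|x y].
  have M0 : 0 <= M := le_trans (normr_ge0 _) (pM x).
  have N0 : 0 <= N := le_trans (normr_ge0 _) (qN x).
  rewrite /Num.max; case: ltP => _.
    by rewrite (le_trans (qN x)) // lerDr.
  by rewrite (le_trans (pM x)) // lerDl.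
by rewrite (le_trans (dist_maxr _ _ _ _)) // mulrDl lerD.
Qed.

(** Extended-valued, so that differences can be estimated before they are known to be square
    integrable. *)
Definition sqnorm f : \bar R := (\int[P]_x (f x ^+ 2)%:E)%E.

Lemma measurable_sqr f : measurable_fun setT f ->
  measurable_fun setT (fun x => (f x ^+ 2)%:E).
Proof. by move=> mf; apply/measurable_EFinP; exact: measurable_funX. Qed.

Lemma le_sqnorm f g : measurable_fun setT f -> measurable_fun setT g ->
  (forall x, `|f x| <= `|g x|) -> (sqnorm f <= sqnorm g)%E.
Proof.
move=> mf mg fg; apply: ge0_le_integral => //.
- by move=> x _; rewrite lee_fin sqr_ge0.
- exact: measurable_sqr.
- exact: measurable_sqr.
- move=> x _; rewrite lee_fin -real_normK ?num_real //.
  by rewrite -[leRHS]real_normK ?num_real // lerXn2r ?nnegrE.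
Qed.

(** The inequality [(a + b)^2 <= 2 a^2 + 2 b^2] stands in for the triangle inequality; it is the
    reason for the tolerances [eta / 4] below. *)
Lemma sqnormD_le f g : measurable_fun setT f -> measurable_fun setT g ->
  (sqnorm (fun x => f x + g x)%R <= 2%:E * sqnorm f + 2%:E * sqnorm g)%E.
Proof.
move=> mf mg; rewrite /sqnorm.
rewrite -!ge0_integralZl_EFin //;
  try by [move=> x _; rewrite lee_fin sqr_ge0|exact: measurable_sqr].
have H (h : Rd R d -> R) : measurable_fun setT h ->
    measurable_fun setT (fun x : Rd R d => (2%:E * (h x ^+ 2)%:E)%E).
  by move=> mh; under eq_fun do rewrite -EFinM; apply/measurable_EFinP;
    apply: measurable_funM => //; exact: measurable_funX.
rewrite -ge0_integralD //; try exact: H;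
  try by move=> x _; rewrite -EFinM lee_fin mulr_ge0 ?sqr_ge0.
apply: ge0_le_integral => //.
- by move=> x _; rewrite lee_fin sqr_ge0.
- by apply: measurable_sqr; exact: measurable_funD.
- by apply: emeasurable_funD; exact: H.
- move=> x _; rewrite -!EFinM -EFinD lee_fin.
  by have := sqr_ge0 (f x - g x); nra.
Qed.

Lemma sqnormZ (c : R) f : measurable_fun setT f ->
  sqnorm (fun x => c * f x)%R = ((c ^+ 2)%:E * sqnorm f)%E.
Proof.
move=> mf; rewrite /sqnorm -ge0_integralZl_EFin //.
- by apply: eq_integral => x _; rewrite -EFinM exprMn.
- by move=> x _; rewrite lee_fin sqr_ge0.
- exact: measurable_sqr.
- exact: sqr_ge0.
Qed.

Definition approximable f := measurable_fun setT f /\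
  forall eta : R, 0 < eta -> exists p, lipb p /\ (sqnorm (fun x => f x - p x)%R < eta%:E)%E.

Lemma lipb_measurable p : lipb p -> measurable_fun (setT : set (Rd R d)) p.
Proof. by move=> /lipb_bc; exact: bc_measurable. Qed.

Lemma lipb_approximable p : lipb p -> approximable p.
Proof.
move=> lp; split; first exact: lipb_measurable.
move=> eta eta0; exists p; split=> //.
rewrite /sqnorm (eq_integral (fun=> 0%E)) ?integral0 ?lte_fin //.
by move=> x _; rewrite subrr expr0n.
Qed.

Lemma approximable_closed f :
  measurable_fun setT f ->
  (forall eta : R, 0 < eta -> exists g, approximable g /\
     (sqnorm (fun x => f x - g x)%R < eta%:E)%E) -> approximable f.
Proof.
move=> mf H; split=> // eta eta0.
have e4 : 0 < eta / 4 by rewrite divr_gt0.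
have [g [[mg ag] fg]] := H _ e4; have [p [lp gp]] := ag _ e4.
exists p; split=> //.
have mp := lipb_measurable lp.
have -> : (fun x => f x - p x) = (fun x => (f x - g x) + (g x - p x)).
  by apply/funext => x; rewrite addrA subrK.
apply: le_lt_trans (sqnormD_le _ _) _; try exact: measurable_funB.
have -> : (eta%:E = 2%:E * (eta / 4)%:E + 2%:E * (eta / 4)%:E)%E.
  by rewrite -!EFinM -EFinD; congr EFin; field.
by apply: lteD; rewrite lte_pmul2l ?fin_numE // ?lte_fin.
Qed.

(** A common proof for sums and maxima, both 1-Lipschitz in each argument. Maxima are wanted for
    unions of sets. *)
Lemma approximable_comb (op : R -> R -> R) f g :
  (forall a b c e, `|op a b - op c e| <= `|a - c| + `|b - e|) ->
  (forall p q, lipb p -> lipb q -> lipb (fun x => op (p x) (q x))) ->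
  measurable_fun setT (fun x => op (f x) (g x)) ->
  approximable f -> approximable g -> approximable (fun x => op (f x) (g x)).
Proof.
move=> Hop lop mop [mf af] [mg ag]; split=> // eta eta0.
have e4 : 0 < eta / 4 by rewrite divr_gt0.
have [p [lp fp]] := af _ e4; have [q [lq gq]] := ag _ e4.
exists (fun x => op (p x) (q x)); split; first exact: lop.
have mp := lipb_measurable lp; have mq := lipb_measurable lq.
have mo := lipb_measurable (lop _ _ lp lq).
have mN (h : Rd R d -> R) : measurable_fun setT h ->
    measurable_fun setT (fun x : Rd R d => `|h x : R|).
  by move=> mh; exact: measurableT_comp.
have sN (h : Rd R d -> R) : sqnorm (fun x => `|h x|)%R = sqnorm h.
  by apply: eq_integral => x _; rewrite real_normK ?num_real.
apply: (@le_lt_trans _ _ (sqnorm (fun x => `|f x - p x| + `|g x - q x|)%R)).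
  apply: le_sqnorm; first exact: measurable_funB.
    by apply: measurable_funD; apply: mN; exact: measurable_funB.
  by move=> x; rewrite [leRHS]ger0_norm ?addr_ge0.
apply: le_lt_trans (sqnormD_le _ _) _; try by apply: mN; exact: measurable_funB.
rewrite !sN.
have -> : (eta%:E = 2%:E * (eta / 4)%:E + 2%:E * (eta / 4)%:E)%E.
  by rewrite -!EFinM -EFinD; congr EFin; field.
by apply: lteD; rewrite lte_pmul2l ?fin_numE // ?lte_fin.
Qed.

Lemma approximableD f g :
  approximable f -> approximable g -> approximable (fun x => f x + g x).
Proof.
move=> af ag; apply: approximable_comb => //.
- by move=> a b c e; rewrite opprD addrACA ler_normD.
- exact: lipb_add.
- by apply: measurable_funD; [case: af|case: ag].
Qed.

Lemma approximable_max f g :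
  approximable f -> approximable g -> approximable (fun x => Num.max (f x) (g x)).
Proof.
move=> af ag; apply: approximable_comb => //.
- exact: dist_maxr.
- exact: lipb_max.
- by apply: measurable_maxr; [case: af|case: ag].
Qed.

Lemma approximableZ (c : R) f : approximable f -> approximable (fun x => c * f x).
Proof.
move=> [mf af]; split; first exact: measurable_funM.
move=> eta eta0.
have c1 : 0 < c ^+ 2 + 1 by rewrite ltr_wpDl ?sqr_ge0.
have e' : 0 < eta / (c ^+ 2 + 1) by rewrite divr_gt0.
have [p [lp fp]] := af _ e'; have mp := lipb_measurable lp.
exists (fun x => c * p x); split; first exact: lipb_scale.
have -> : (fun x => c * f x - c * p x) = (fun x => c * (f x - p x)).
  by apply/funext => x; rewrite mulrBr.
rewrite sqnormZ; last exact: measurable_funB.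
apply: (@le_lt_trans _ _ ((c ^+ 2 + 1)%:E * sqnorm (fun x => (f x - p x)%R)%R)%E).
  apply: lee_wpmul2r; first by apply: integral_ge0 => x _; rewrite lee_fin sqr_ge0.
  by rewrite lee_fin lerDl.
have -> : (eta%:E = (c ^+ 2 + 1)%:E * (eta / (c ^+ 2 + 1))%:E)%E.
  by rewrite -EFinM mulrC divfK // gt_eqF.
by rewrite lte_pmul2l ?fin_numE // lte_fin.
Qed.

Lemma ecvg0_lt (u : nat -> \bar R) (eta : R) : u @ \oo --> 0%E -> 0 < eta ->
  exists n, (u n < eta%:E)%E.
Proof.
move=> /fine_cvgP[fin c] eta0.
have : \forall n \near \oo, (u n < eta%:E)%E.
  have /cvgrPdist_lt /(_ _ eta0) := c; apply: filterS2 fin => n fn.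
  rewrite sub0r normrN /= => h; rewrite -(fineK fn) lte_fin.
  exact: le_lt_trans (ler_norm _) h.
by move=> [n _ H]; exists n; apply: H => /=.
Qed.

(** Dominated convergence for the squared errors, with dominant [g ^ 2]. *)
Lemma approximable_lim (F : nat -> Rd R d -> R) f g :
  (forall n, approximable (F n)) -> measurable_fun setT f ->
  P.-integrable setT (fun x => (g x ^+ 2)%:E) ->
  (forall n x, `|f x - F n x| <= `|g x|) ->
  (forall x, (fun n => F n x) @ \oo --> f x) -> approximable f.
Proof.
move=> aF mf ig bF cF; apply: approximable_closed => // eta eta0.
suff [n Hn] : exists n, (sqnorm (fun x => f x - F n x)%R < eta%:E)%E by exists (F n).
apply: ecvg0_lt eta0.
have mF n : measurable_fun setT (fun x => ((f x - F n x) ^+ 2)%:E).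
  by apply: measurable_sqr; apply: measurable_funB => //; case: (aF n).
have c0 : {ae P, forall x, setT x ->
    (fun n => ((f x - F n x) ^+ 2)%:E) @ \oo --> (cst 0%E : Rd R d -> \bar R) x}.
  apply: aeW => x _; apply: cvg_EFin; first by near=> n.
  have c1 : (fun n => f x - F n x) @ \oo --> f x - f x.
    by apply: cvgB; [exact: cvg_cst|exact: cF].
  have := cvgM c1 c1; rewrite subrr mul0r; exact.
have dom : {ae P, forall x n, setT x ->
    (`|((f x - F n x) ^+ 2)%:E| <= (g x ^+ 2)%:E)%E}.
  apply: aeW => x n _; rewrite /= lee_fin ger0_norm ?sqr_ge0 //.
  by rewrite -real_normK ?num_real // -[leRHS]real_normK ?num_real // lerXn2r ?nnegrE.
have [_ _] := dominated_convergence measurableT mF (measurable_cst 0%E) c0 ig dom.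
by rewrite integral0.
Unshelve. all: by end_near. Qed.

Definition distset (A : set vec) (x : vec) : R := inf [set `|x - a| | a in A].

Lemma distset_lb (A : set vec) x : has_lbound [set `|x - a| | a in A].
Proof. by exists 0 => _ [a _ <-]. Qed.

Lemma distset_ge0 (A : set vec) x : A !=set0 -> 0 <= distset A x.
Proof.
move=> [a Aa]; apply: lb_le_inf; first by exists `|x - a|; exists a.
by move=> _ [b _ <-].
Qed.

Lemma distset_lip (A : set vec) x y : A !=set0 ->
  `|distset A x - distset A y| <= `|x - y|.
Proof.
move=> A0.
have H u v : distset A u - distset A v <= `|u - v|.
  rewrite lerBlDl -lerBlDr; apply: lb_le_inf.
    by have [a Aa] := A0; exists `|v - a|; exists a.
  move=> _ [a Aa <-]; rewrite lerBlDr.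
  apply: (@le_trans _ _ `|u - a|); first by apply: ge_inf; [exact: distset_lb|exists a].
  by rewrite [leRHS]addrC (le_trans _ (ler_normD _ _)) // addrA subrK.
by rewrite ler_norml H andbT lerNl opprB (distrC x) H.
Qed.

Lemma distset_in (A : set vec) x : A x -> distset A x = 0.
Proof.
move=> Ax; apply/eqP; rewrite eq_le distset_ge0 ?andbT; last by exists x.
by apply: ge_inf; [exact: distset_lb|exists x; rewrite ?subrr ?normr0].
Qed.

Lemma distset_gt0 (U : set vec) x : open U -> ~` U !=set0 -> U x ->
  0 < distset (~` U) x.
Proof.
move=> oU U0 Ux; have /nbhs_ballP[e /= e0 eU] := open_nbhs_nbhs (conj oU Ux).
apply: (lt_le_trans e0); apply: lb_le_inf.
  by have [a Aa] := U0; exists `|x - a|; exists a.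
move=> _ [a Ua <-]; rewrite leNgt; apply/negP => xa; apply: Ua; apply: eU.
by rewrite -ball_normE.
Qed.

(** The Lipschitz functions [min 1 (n dist (x, complement of U))] tend to the indicator because the
    complement is closed. An empty complement is treated apart, the distance to it having no
    meaning. *)
Lemma indic_open_approximable (U : set (Rd R d)) : @open vec U -> approximable \1_U.
Proof.
move=> oU; have [U0|U0] := pselect (~` U !=set0); last first.
  have -> : U = setT.
    by apply/seteqP; split=> // x _; apply: contrapT => Ux; apply: U0; exists x.
  rewrite indicT; apply: lipb_approximable; exact: lipb_cst.
pose F n x := Num.min 1 (n%:R * distset (~` U) x).
have D0 x := distset_ge0 x U0.
have lF n : lipb (F n).
  have -> : F n = (fun x => - Num.max (-1) (- (n%:R * distset (~` U) x))).
    by apply/funext => x; rewrite oppr_max !opprK.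
  exists (1 + n%:R); split=> [x|x y].
    rewrite oppr_max !opprK ger0_norm; last by rewrite le_min ler01 mulr_ge0.
    by rewrite ge_min lerDl ler0n.
  rewrite -opprD normrN (le_trans (dist_maxr _ _ _ _)) // subrr normr0 add0r.
  rewrite -opprD normrN -mulrBr normrM ger0_norm //.
  apply: (@le_trans _ _ (n%:R * `|x - y|)).
    by rewrite ler_wpM2l // distset_lip.
  by rewrite ler_wpM2r // lerDr.
have mU : measurable U by apply: sub_sigma_algebra.
apply: (@approximable_lim F _ (fun=> 1)).
- by move=> n; exact: lipb_approximable.
- exact: measurable_indic.
- by apply: (@bounded_integrable _ _ P (fun=> 1 ^+ 2) 1) => // x; rewrite expr1n normr1.
- move=> n x; rewrite normr1 indicE /F.
  have h0 : 0 <= n%:R * distset (~` U) x by rewrite mulr_ge0.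
  rewrite ler_norml; case: (x \in U) => /=; rewrite /Num.min; case: ltP => h;
    by apply/andP; split; lra.
- move=> x; rewrite indicE; have [xU|xU] := boolP (x \in U); last first.
    rewrite /F distset_in; last by apply/set_mem; rewrite in_setC.
    by under eq_fun do rewrite mulr0 min_r ?ler01 //; exact: cvg_cst.
  have dx := distset_gt0 oU U0 (set_mem xU).
  apply: cvg_near_cst; near=> n; rewrite /F min_l // -ler_pdivrMr // mul1r.
  by near: n; exact: nbhs_infty_ger.
Unshelve. all: by end_near. Qed.

(** Good sets argument: the sets with approximable indicator include the open ones and are stable
    under complements, through [1 - 1_A], and under countable unions, as limits of finite unions,
    whose indicators are maxima. *)
Lemma indic_approximable (A : set (Rd R d)) : measurable A -> approximable \1_A.
Proof.
move=> mA; suff: [set A : set (Rd R d) | measurable A /\ approximable \1_A] A by case.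
move: A mA; apply: smallest_sub; last first.
  by move=> U oU; split; [exact: sub_sigma_algebra|exact: indic_open_approximable].
split.
- split; first exact: measurable0.
  rewrite indic0; apply: lipb_approximable; exact: lipb_cst.
- move=> A [mA aA]; split; first by rewrite setTD; exact: measurableC.
  have -> : \1_(setT `\` A) = (fun x => 1 + (-1) * \1_A x) :> (Rd R d -> R).
    apply/funext => x; rewrite setTD !indicE in_setC.
    by case: (x \in A) => /=; rewrite ?mulr1 ?mulr0 ?addr0 ?subrr.
  by apply: approximableD; [apply: lipb_approximable; exact: lipb_cst|exact: approximableZ].
- move=> A' HA; pose A : nat -> set (Rd R d) := A'.
  have mA : measurable (\bigcup_k A k).
    by apply: bigcup_measurable => k _; case: (HA k).
  split=> //.
  pose F n : Rd R d -> R := \1_(\bigcup_(i < n) A i).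
  apply: (@approximable_lim F _ (fun=> 1)).
  + elim=> [|n IH].
      rewrite /F bigcup_mkord big_ord0 indic0; apply: lipb_approximable; exact: lipb_cst.
    have -> : F n.+1 = (fun x => Num.max (F n x) (\1_(A n) x)).
      apply/funext => x; rewrite /F !bigcup_mkord big_ord_recr /= !indicE in_setU.
      by case: (_ \in _); case: (_ \in _); rewrite /= ?maxxx // ?(max_l ler01) ?(max_r ler01).
    by apply: approximable_max => //; case: (HA n).
  + exact: measurable_indic.
  + by apply: (@bounded_integrable _ _ P (fun=> 1 ^+ 2) 1) => // x; rewrite expr1n normr1.
  + move=> n x; rewrite normr1 /F !indicE.
    by do 2 case: (_ \in _); rewrite /= ?subrr ?subr0 ?sub0r ?normrN ?normr0 ?normr1.
  + move=> x; rewrite indicE; apply: cvg_near_cst.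
    have [xA|xA] := boolP (x \in _).
      have [k _ Akx] := set_mem xA.
      near=> n; rewrite /F indicE mem_set //; exists k => //=.
      by near: n; exact: nbhs_infty_gt.
    near=> n; rewrite /F indicE memNset // => -[k _ Akx].
    by move/negP: xA; apply; apply/mem_set; exists k.
Unshelve. all: by end_near. Qed.

Lemma approximable_sum (I : Type) (r : seq I) (F : I -> Rd R d -> R) :
  (forall i, approximable (F i)) -> approximable (fun x => \sum_(i <- r) F i x).
Proof.
move=> H; elim: r => [|a r IH].
  under eq_fun do rewrite big_nil; apply: lipb_approximable; exact: lipb_cst.
by under eq_fun do rewrite big_cons; exact: approximableD.
Qed.

Import HBNNSimple.

(** The simple functions increasing to [f] are finite combinations of indicators, and [f] itself
    dominates the errors. *)
Lemma nonneg_approximable f : measurable_fun setT f -> (forall x, 0 <= f x) ->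
  P.-integrable setT (fun x => (f x ^+ 2)%:E) -> approximable f.
Proof.
move=> mf f0 f2.
have mfE : measurable_fun setT (EFin \o f) by exact/measurable_EFinP.
pose F := nnsfun_approx measurableT mfE.
have cF x : (fun n => F n x) @ \oo --> f x.
  have := cvg_nnsfun_approx measurableT mfE
    (fun x _ => f0 x : (0 <= (f x)%:E)%E) (I : setT x).
  by move=> /fine_cvg.
have ndF := nd_nnsfun_approx measurableT mfE.
have leF n x : F n x <= f x.
  rewrite -(cvg_lim _ (cF x)) //; apply: nondecreasing_cvgn_le.
    by move=> a b ab; have /lefP := ndF a b ab; apply.
  by apply/cvg_ex; exists (f x).
apply: (@approximable_lim (fun n => F n) _ f) => //.
- move=> n; have /funext -> := fimfunEord (F n).
  apply: approximable_sum => y; apply: approximableZ; apply: indic_approximable.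
  by rewrite -[X in measurable X]setTI; exact: measurable_funP.
- by move=> n x; rewrite !ger0_norm // ?subr_ge0 // gerBl.
Qed.

Lemma L2_approximable f : measurable_fun setT f ->
  P.-integrable setT (fun x => (f x ^+ 2)%:E) -> approximable f.
Proof.
move=> mf f2.
have -> : f = (fun x => Num.max (f x) 0 + (-1) * Num.max (- f x) 0).
  by apply/funext => x; rewrite /Num.max; do 2 case: ltP => ?; lra.
(* Meant for [g = f] and [g = - f], whose squares agree. *)
have H (g : Rd R d -> R) : measurable_fun setT g -> (forall x, g x ^+ 2 = f x ^+ 2) ->
    approximable (fun x => Num.max (g x) 0).
  move=> mg gf; have mg0 : measurable_fun setT (fun x : Rd R d => Num.max (g x) 0).
    by apply: measurable_maxr => //; exact: measurable_cst.
  apply: nonneg_approximable => // [x|]; first by rewrite le_max lexx orbT.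
  apply: le_integrable f2 => //; first exact: measurable_sqr.
  move=> x _; rewrite /= lee_fin !ger0_norm ?sqr_ge0 // -gf /Num.max.
  by case: ltP => // _; rewrite expr0n sqr_ge0.
apply: approximableD; first exact: H.
apply: approximableZ; apply: H => [|x]; last by rewrite sqrrN.
exact: measurableT_comp.
Qed.

End LipschitzDensity.

(** * Limits of real sequences *)

Section SequenceLimits.
Variables (R : realType).

Lemma cvgn_dist_lt (u : nat -> R) (l e : R) : u @ \oo --> l -> 0 < e ->
  exists N, forall n, (N <= n)%N -> `|u n - l| < e.
Proof.
move=> /cvgrPdist_lt H e0; have [N _ HN] := H _ e0.
by exists N => n Nn; rewrite distrC; exact: HN.
Qed.

Lemma cvgn_sum (I : Type) (r : seq I) (u : I -> nat -> R) (l : I -> R) :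
  (forall i, u i @ \oo --> l i) ->
  (fun n => \sum_(i <- r) u i n) @ \oo --> \sum_(i <- r) l i.
Proof.
move=> H; elim: r => [|a r IH].
  by under eq_fun do rewrite big_nil; rewrite big_nil; exact: cvg_cst.
under eq_fun do rewrite big_cons.
by rewrite big_cons; apply: cvgD.
Qed.

End SequenceLimits.

(** * The limit measure as a convolution with a contracted tail *)

Section Convolution.
Variables (R : realType) (d : nat).
Notation vec := 'cV[R]_d.
Notation bc := (@bounded_continuous R d).

Lemma avg_allpairs (s t : seq vec) (g : vec -> vec -> vec) (f : vec -> R) :
  avg [seq g x y | x <- s, y <- t] f = avg s (fun x => avg t (fun y => f (g x y))).
Proof.
rewrite /avg size_allpairs natrM invfM -mulrA big_allpairs_dep /=; congr (_ * _).
by rewrite mulr_sumr.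
Qed.

Variables (Rs : nat -> 'M[int]_d) (Bs : nat -> seq 'cV[int]_d).
Hypothesis adm : forall n, admissible R (Rs n) (Bs n).
Variables (mu : probability (Rd R d) R) (n : nat) (nun : probability (Rd R d) R).
Hypothesis mu_lim : weak_conv_pts (fun n => convpts R Rs Bs 0 n) mu.
Hypothesis nun_lim : weak_conv_pts (fun k => convpts R Rs Bs n k) nun.

Local Notation Q := (invmx (prodR R Rs 0 n)).
Local Notation s := (convpts R Rs Bs 0 n).

(** Both sides are limits of the averages over the first [n + k] factors: one by convergence to
    [mu], the other by convergence to the tail, applied to the finitely many functions
    [y |-> f (x + Q y)]. *)
Lemma Rint_conv f : bc f -> Rintegral mu setT f =
  avg s (fun x => Rintegral nun setT (fun y => f (x + Q *m y))).
Proof.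
move=> bf.
have c1 : (fun k => avg (convpts R Rs Bs 0 (k + n)) f) @ \oo --> Rintegral mu setT f.
  by have := mu_lim bf; rewrite -(cvg_shiftn n).
have c2 : (fun k => avg (convpts R Rs Bs 0 (k + n)) f) @ \oo -->
    avg s (fun x => Rintegral nun setT (fun y => f (x + Q *m y))).
  under eq_fun do rewrite addnC (convpts_cat adm) avg_allpairs add0n.
  apply: cvgM; first exact: cvg_cst.
  by apply: cvgn_sum => x; apply: nun_lim; exact: bc_affine.
by rewrite -(cvg_lim (@Rhausdorff R) c1) (cvg_lim (@Rhausdorff R) c2).
Qed.

Lemma cint_conv (f : vec -> R[i]) : cbc f -> cint mu f =
  Complex (size s)%:R^-1 0 * \sum_(x <- s) cint nun (fun y => f (x + Q *m y)).
Proof.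
move=> [bR bI]; rewrite /cint !Rint_conv // /avg.
apply/eqP; rewrite eq_complex ReM ImM Re_sum Im_sum /= !mul0r subr0 addr0.
by rewrite !eqxx.
Qed.

(** The exponential sum over the atoms of [mu_n] is a factor, so frequencies orthogonal for [mu_n]
    are orthogonal for [mu]. *)
Lemma fhat_conv (l : vec) : fhat mu l =
  Complex (size s)%:R^-1 0 * (\sum_(x <- s) chi l x) * fhat nun (Q^T *m l).
Proof.
rewrite /fhat cint_conv; last exact: cbc_chi.
rewrite -mulrA; congr (_ * _); rewrite mulr_suml; apply: eq_bigr => x _.
under eq_fun do rewrite chiDr chi_mulr.
by rewrite cint_scale //; exact: cbc_chi.
Qed.

End Convolution.

(** * Uniform lower bounds for the transforms of the tails *)

Section EquiPositivity.
Variables (R : realType) (d : nat).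
Notation vec := 'cV[R]_d.
Notation bc := (@bounded_continuous R d).

Lemma MVT_dist (f df : R -> R) (K : R) (a b : R) :
  (forall x : R, is_derive x 1 f (df x)) -> (forall x, `|df x| <= K) ->
  `|f a - f b| <= K * `|a - b|.
Proof.
move=> Hd HK.
wlog ab : a b / b <= a.
  by move=> W; have [|/ltW] := leP b a; [exact: W|rewrite distrC (distrC a); exact: W].
have cf : continuous f.
  by move=> x; apply: differentiable_continuous; apply/derivable1_diffP; case: (Hd x).
have [c _ ->] := MVT_segment ab (fun x _ => Hd x) (continuous_subspaceT cf).
by rewrite normrM ler_wpM2r.
Qed.

Lemma dist_cos (a b : R) : `|cos a - cos b| <= `|a - b|.
Proof.
rewrite -[leRHS]mul1r; apply: (MVT_dist _ _ (@is_derive_cos R)) => x.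
by rewrite normrN ler_norml sin_geN1 sin_le1.
Qed.

Lemma dist_sin (a b : R) : `|sin a - sin b| <= `|a - b|.
Proof.
rewrite -[leRHS]mul1r; apply: (MVT_dist _ _ (@is_derive_sin R)) => x.
by rewrite ler_norml cos_geN1 cos_le1.
Qed.

(** A bounded continuous substitute for [eta |y|], which need not be integrable. It dominates
    differences of characters, and weak convergence applies to it, so no separate tightness argument
    is called for. *)
Definition tnorm (eta : R) (y : vec) : R := Num.min 1 (eta * `|y|).

Lemma bc_tnorm (eta : R) : 0 <= eta -> bc (tnorm eta).
Proof.
move=> e0; split; last first.
  exists 1 => x; rewrite ger0_norm; first by rewrite ge_min lexx.
  by rewrite le_min ler01 mulr_ge0.
apply: (@lipschitz_continuous_norm _ _ _ _ eta) => x y.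
have -> : tnorm eta = (fun x => - Num.max (-1) (- (eta * `|x|))).
  by apply/funext => z; rewrite oppr_max !opprK.
rewrite -opprD normrN (le_trans (dist_maxr _ _ _ _)) // subrr normr0 add0r.
rewrite -opprD normrN -mulrBr normrM ger0_norm // ler_wpM2l //.
by rewrite ler_dist_dist.
Qed.

Lemma tnorm_ge0 (eta : R) y : 0 <= eta -> 0 <= tnorm eta y.
Proof. by move=> e0; rewrite le_min ler01 mulr_ge0. Qed.

Lemma tnorm_small (P : probability (Rd R d) R) (e : R) : 0 < e ->
  exists eta, 0 < eta /\ Rintegral P setT (tnorm eta) < e.
Proof.
move=> e0.
pose F (n : nat) (x : Rd R d) := (tnorm n.+1%:R^-1 x)%:E.
have bF n : bc (tnorm n.+1%:R^-1) by apply: bc_tnorm; rewrite invr_ge0.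
have mF n : measurable_fun setT (F n).
  by apply/measurable_EFinP; exact: bc_measurable.
have c0 : {ae P, forall x, setT x -> F ^~ x @ \oo --> (cst 0%E : Rd R d -> \bar R) x}.
  apply: aeW => x _; apply: cvg_EFin; first by near=> n.
  apply/cvgrPdist_lt => r r0; rewrite /F /=.
  have x1 : 0 < `|x : vec| + 1 by rewrite ltr_wpDl.
  have rx : 0 < r / (`|x : vec| + 1) by rewrite divr_gt0.
  near=> n; rewrite sub0r normrN ger0_norm; last by apply: tnorm_ge0; rewrite invr_ge0.
  rewrite gt_min; apply/orP; right.
  apply: (@le_lt_trans _ _ (n.+1%:R^-1 * (`|x : vec| + 1))).
    by rewrite ler_wpM2l ?invr_ge0 // lerDl.
  rewrite -ltr_pdivlMr //.
  by near: n; exact: (near_infty_natSinv_lt (PosNum rx)).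
have dom : {ae P, forall x n, setT x -> (`|F n x| <= (1 : R)%:E)%E}.
  apply: aeW => x n _; rewrite /F /= lee_fin ger0_norm; last first.
    by apply: tnorm_ge0; rewrite invr_ge0.
  by rewrite ge_min lexx.
have i1 : P.-integrable setT (fun=> (1 : R)%:E).
  by apply: (bc_integrable P (f := fun=> 1)); exact: bc_cst.
have [_ _] := dominated_convergence measurableT mF (measurable_cst 0%E) c0 i1 dom.
rewrite integral0 => c.
have [n Hn] := ecvg0_lt c e0.
exists n.+1%:R^-1; split; first by rewrite invr_gt0.
have fin : (\int[P]_x F n x)%E \is a fin_num.
  by apply: integrable_fin_num => //; exact: (bc_integrable P (bF n)).
by rewrite -lte_fin /Rintegral fineK.
Unshelve. all: by end_near. Qed.

Definition freqK : R := 2 * pi * d%:R.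

Lemma freqK_ge0 : 0 <= freqK.
Proof. by rewrite !mulr_ge0 // pi_ge0. Qed.

(** The oscillation [c] of a cosine or sine is at most 2 and at most the phase difference; the
    truncated norm captures both bounds at once. *)
Lemma dist_phase_le (xi w y : vec) (c : R) (eta : R) :
  0 <= c -> c <= 2 -> c <= `|2 * pi * dotv xi y - 2 * pi * dotv w y| ->
  freqK * `|xi - w| <= eta -> c <= 2 * tnorm eta y.
Proof.
move=> c0 c2 cd Ke.
have H : c <= eta * `|y|.
  apply: (le_trans cd); rewrite -mulrBr -dotvNl -dotvDl !normrM.
  rewrite (ger0_norm (ler0n _ 2)) (ger0_norm (pi_ge0 R)).
  apply: (@le_trans _ _ (freqK * `|xi - w| * `|y|)); last by rewrite ler_wpM2r.
  rewrite /freqK -!mulrA ler_wpM2l // ler_wpM2l ?pi_ge0 //.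
  by rewrite mulrA; exact: norm_dotv.
have h0 : 0 <= eta * `|y| := le_trans c0 H.
by rewrite /tnorm /Num.min; case: ltP => _; lra.
Qed.

Lemma fhat_equicont (P : probability (Rd R d) R) (xi w : vec) (eta : R) :
  0 <= eta -> freqK * `|xi - w| <= eta ->
  `|Re (fhat P xi) - Re (fhat P w)| <= 2 * Rintegral P setT (tnorm eta) /\
  `|Im (fhat P xi) - Im (fhat P w)| <= 2 * Rintegral P setT (tnorm eta).
Proof.
move=> e0 Ke; have bt := bc_tnorm e0.
have b2 : bc (fun y => 2 * tnorm eta y) by apply: bc_mul => //; exact: bc_cst.
have main (f g : vec -> R) : bc f -> bc g ->
    (forall y, `|f y - g y| <= 2 * tnorm eta y) ->
    `|Rintegral P setT f - Rintegral P setT g| <= 2 * Rintegral P setT (tnorm eta).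
  move=> bf bg H; rewrite -Rint_scale // ler_norml; apply/andP; split.
    rewrite lerNl opprB -Rint_sub //; apply: Rint_le => //; first exact: bc_sub.
    by move=> y; rewrite (le_trans (ler_norm _)) // distrC.
  rewrite -Rint_sub //; apply: Rint_le => //; first exact: bc_sub.
  by move=> y; rewrite (le_trans (ler_norm _)).
rewrite !fhatE /=; split.
  apply: main; try exact: bc_cos; move=> y; apply: dist_phase_le Ke => //.
    rewrite (le_trans (ler_normB _ _)) // -[leRHS]/(1 + 1).
    by rewrite lerD // ler_norml cos_geN1 cos_le1.
  exact: dist_cos.
rewrite -opprD normrN.
apply: main; try exact: bc_sin; move=> y; apply: dist_phase_le Ke => //.
  rewrite (le_trans (ler_normB _ _)) // -[leRHS]/(1 + 1).
  by rewrite lerD // ler_norml sin_geN1 sin_le1.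
exact: dist_sin.
Qed.

Lemma nsq_ge_of_close (z w : R[i]) (c : R) : 0 < c ->
  (2 * c <= `|Re w| \/ 2 * c <= `|Im w|) ->
  `|Re z - Re w| <= c -> `|Im z - Im w| <= c -> c ^+ 2 <= nsq z.
Proof.
move=> c0 H hR hI.
have sq (a : R) : c <= `|a| -> c ^+ 2 <= a ^+ 2.
  by move=> ca; rewrite -[leRHS]real_normK ?num_real // lerXn2r ?nnegrE // ltW.
have far (a b : R) : 2 * c <= `|b| -> `|a - b| <= c -> c <= `|a|.
  move=> hb hab; have : `|b| <= `|a| + `|a - b|.
    by rewrite distrC -{1}(subrK a b) addrC ler_normD.
  by lra.
case: H => H.
  by rewrite (le_trans (sq _ (far _ _ H hR))) // lerDl sqr_ge0.
by rewrite (le_trans (sq _ (far _ _ H hI))) // lerDr sqr_ge0.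
Qed.

Variables (nuJ : nat -> probability (Rd R d) R) (nu : probability (Rd R d) R).
Hypothesis nuJ_lim : weak_conv nuJ nu.

(** Weak convergence is tested on three functions: cosine and sine at [w] give the value at [w], and
    [tnorm eta] controls the passage from [w] to a nearby [z], uniformly in [j]. *)
Lemma fhat_local_pos (w : vec) : fhat nu w != 0 ->
  exists e delta J, [/\ (0 : R) < e, (0 : R) < delta &
    forall j z, (J <= j)%N -> `|z - w| < delta -> e <= nsq (fhat (nuJ j) z)].
Proof.
move=> w0.
have [c [c0 Hc]] : exists c : R, 0 < c /\
    (2 * c <= `|Re (fhat nu w)| \/ 2 * c <= `|Im (fhat nu w)|).
  have := w0; rewrite eq_complex negb_and => /orP[] h.
    exists (`|Re (fhat nu w)| / 2); split; first by rewrite divr_gt0 ?normr_gt0.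
    by left; rewrite mulrC divfK.
  exists (`|Im (fhat nu w)| / 2); split; first by rewrite divr_gt0 ?normr_gt0.
  by right; rewrite mulrC divfK.
(* Against [nuJ j] the truncated norm will integrate to less than [c / 4], so the transform varies
   by at most [c / 2] between [w] and [z]; convergence at [w] costs another [c / 8], and the total
   stays below [c]. *)
have c8 : 0 < c / 8 by rewrite divr_gt0.
have [eta [eta0 Heta]] := tnorm_small nu c8.
have bt := bc_tnorm (ltW eta0).
have [J1 H1] := cvgn_dist_lt (nuJ_lim bt) c8.
have [J2 H2] := cvgn_dist_lt (nuJ_lim (bc_cos w)) c8.
have [J3 H3] := cvgn_dist_lt (nuJ_lim (bc_sin w)) c8.
have K1 : 0 < freqK + 1 by rewrite ltr_wpDl // freqK_ge0.
exists (c ^+ 2), (eta / (freqK + 1)), (maxn J1 (maxn J2 J3)); split.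
- by rewrite exprn_gt0.
- by rewrite divr_gt0.
- move=> j z; rewrite !geq_max => /and3P[j1 j2 j3] zw.
  have Ke : freqK * `|z - w| <= eta.
    apply: (@le_trans _ _ ((freqK + 1) * `|z - w|)).
      by rewrite ler_wpM2r // lerDl.
    by rewrite mulrC -ler_pdivlMr // ltW.
  have [] := fhat_equicont (nuJ j) (ltW eta0) Ke.
  have := H1 _ j1; have := H2 _ j2; have := H3 _ j3.
  move: Hc; rewrite !(fhatE _ w) /=; set A := Rintegral _ _ _; set B := Rintegral _ _ _.
  set B' := Rintegral (nuJ j) _ _; set A' := Rintegral (nuJ j) _ _.
  set T' := Rintegral (nuJ j) _ _ => Hc hB hA hT hR hI.
  have T0 : T' < c / 4.
    by move: hT; rewrite ltr_distl => /andP[_]; lra.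
  apply: (@nsq_ge_of_close _ (Complex A (- B))) => //=.
    apply: (@le_trans _ _ (`|Re (fhat (nuJ j) z) - A'| + `|A' - A|)).
      by rewrite (le_trans _ (ler_normD _ _)) // addrA subrK.
    by lra.
  apply: (@le_trans _ _ (`|Im (fhat (nuJ j) z) - - B'| + `|- B' - - B|)).
    by rewrite (le_trans _ (ler_normD _ _)) // addrA subrK.
  by rewrite -[- B' - - B]opprD normrN; lra.
Qed.

Hypothesis nuZ : Zset nu = set0.

Lemma cube_compact : compact [set v : vec | forall i, `[0, 1]%classic (v i ord0)].
Proof.
have -> : [set v : vec | forall i, `[0, 1]%classic (v i ord0)] =
    trmx @` [set v : 'rV[R]_d | forall i, `[0, 1]%classic (v ord0 i)].
  apply/seteqP; split=> [v Hv|_ [v Hv <-] i].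
    by exists v^T; [move=> i; rewrite mxE; exact: Hv|rewrite trmxK].
  by rewrite mxE; exact: Hv.
apply: (@continuous_compact _ _ (@trmx R 1 d)); last first.
  apply: (@rV_compact _ _ (fun=> `[(0 : R), 1]%classic)) => _.
  exact: segment_compact.
apply: continuous_subspaceT.
apply: (@lipschitz_continuous_norm R 'rV[R]_d vec (@trmx R 1 d) 1) => x y.
by rewrite -linearB /= norm_trmx mul1r.
Qed.

(** The clause [xi = 0 -> k = 0] keeps 0 in the shifted spectra, hence old frequencies in the
    enlarged ones. The margin [y] leaves room for the rescaled images of these old frequencies. *)
Lemma equi_positivity : exists e delta J, [/\ (0 : R) < e, (0 : R) < delta &
  forall j xi, (J <= j)%N -> exists k : vec, [/\ Zd k, xi = 0 -> k = 0 &
    forall y, `|y| < delta -> e <= nsq (fhat (nuJ j) (xi + k + y))]].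
Proof.
(* One index [m] encodes the two bounds, both [1 / (m + 1)], and the starting index, so that the
   near-covering form of compactness delivers all three together. *)
pose Pm (m : nat) (xi : vec) := forall j, (m <= j)%N -> exists k : vec, Zd k /\
  forall y, `|y| < m.+1%:R^-1 -> m.+1%:R^-1 <= nsq (fhat (nuJ j) (xi + k + y)).
have /compact_near_coveringP /(_ nat \oo Pm _) := cube_compact.
case=> [xi0 _|m _ /(_ m (leqnn m)) Hm].
  have [k Zk nz] : exists2 k, Zd k & fhat nu (xi0 + k) != 0.
    apply: contrapT => H; have : Zset nu xi0.
      move=> k Zk; apply/fourier_zeroP; apply/eqP/negPn/negP => nz.
      by apply: H; exists k.
    by rewrite nuZ.
  have [e [dl [J [e0 d0 H]]]] := fhat_local_pos nz.
  have d2 : 0 < dl / 2 by rewrite divr_gt0.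
  have nb : \forall x \near xi0, `|x - xi0| < dl / 2.
    by apply/nbhs_ballP; exists (dl / 2) => //= x; rewrite -ball_normE /= distrC.
  near=> xi m => /= j mj; exists k; split=> // y ym.
  apply: (@le_trans _ _ e).
    by apply: ltW; near: m; exact: (near_infty_natSinv_lt (PosNum e0)).
  apply: H.
    by apply: (leq_trans _ mj); near: m; exact: nbhs_infty_ge.
  have -> : xi + k + y - (xi0 + k) = (xi - xi0) + y.
    by apply/matrixP => a b; rewrite !mxE; ring.
  rewrite (le_lt_trans (ler_normD _ _)) // [ltRHS](splitr dl); apply: ltrD.
    by near: xi; exact: nb.
  apply: (lt_trans ym).
  by near: m; exact: (near_infty_natSinv_lt (PosNum d2)).
(* The origin is handled apart, with translate 0, since the transform of [nu] is 1 there. *)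
have [e [dl [J [e0 d0 H0]]]] : exists e delta J, [/\ (0 : R) < e, (0 : R) < delta &
    forall j z, (J <= j)%N -> `|z - 0| < delta -> e <= nsq (fhat (nuJ j) z)].
  by apply: fhat_local_pos; rewrite fhat0 oner_eq0.
have i0 : 0 < m.+1%:R^-1 :> R by rewrite invr_gt0.
exists (Num.min e m.+1%:R^-1), (Num.min dl m.+1%:R^-1), (maxn J m); split.
- by rewrite lt_min e0.
- by rewrite lt_min d0.
- move=> j xi; rewrite geq_max => /andP[Jj mj].
  have [->|xi0] := eqVneq xi 0.
    exists 0; split=> // [|y]; first exact: Zd0.
    rewrite lt_min => /andP[yd _]; rewrite !add0r ge_min; apply/orP; left.
    by apply: H0; rewrite ?subr0.
  (* Removing the integer part brings [xi] into the cube; the translate found there is corrected by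
     [fl]. *)
  pose fl : 'cV[int]_d := \col_i Num.floor (xi i ord0).
  have := Hm (xi - intmx R fl) _ j mj; case=> [i /=|k [Zk Hk]].
    rewrite in_itv /= !mxE.
    have /andP[h1 h2] := floor_itv (xi i ord0).
    by rewrite subr_ge0 h1 lerBlDl -[1]/(1%:~R) -intrD ltW.
  exists (k - intmx R fl); split=> [|xi00|y].
  + by apply: ZdD => //; apply: ZdN; exists fl.
  + by rewrite xi00 eqxx in xi0.
  + rewrite lt_min => /andP[_ ym]; rewrite ge_min; apply/orP; right.
    have -> : xi + (k - intmx R fl) + y = xi - intmx R fl + k + y.
      by apply/matrixP => a b; rewrite !mxE; ring.
    exact: Hk.
Unshelve. all: by end_near. Qed.

End EquiPositivity.

(** * The increasing sequence of finite spectra *)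

Section Construction.
Variables (R : realType) (d : nat).
Notation vec := 'cV[R]_d.
Variables (Rs : nat -> 'M[int]_d) (Bs : nat -> seq 'cV[int]_d).

Local Notation prodR := (prodR R Rs).
Local Notation convpts := (convpts R Rs Bs).
Local Notation Q n := (invmx (prodR 0 n)).

Lemma convpts_nil m n k : (n < k)%N -> Bs (m + n) = [::] -> convpts m k = [::].
Proof.
move=> nk B0; elim: k nk => // k IH; rewrite ltnS leq_eqVlt => /orP[/eqP <-|/IH E] /=.
  by rewrite /digits /= B0 allpairs0r.
by rewrite E.
Qed.

(** An empty digit set would empty all later lists, making the averages of the constant 1 vanish,
    whereas they tend to its integral 1. *)
Lemma Bs_neq0 (mu : probability (Rd R d) R) :
  weak_conv_pts (fun n => convpts 0 n) mu -> forall n, Bs n != [::].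
Proof.
move=> mu_lim n; apply/negP => /eqP B0.
have [N HN] := cvgn_dist_lt (mu_lim _ (bc_cst d 1)) ltr01.
have := HN (n.+1 + N)%N (leq_addl _ _).
rewrite (@convpts_nil 0 n) ?leq_addr // /avg big_nil mulr0 Rint_cst.
by rewrite sub0r normrN normr1 ltxx.
Qed.

Hypothesis adm : forall n, admissible R (Rs n) (Bs n).
Hypothesis Bs0 : forall n, Bs n != [::].
Hypothesis Q0 : (fun n => `|invprod R Rs n|) @ \oo --> (0 : R).

Lemma norm_invprod_small (c e : R) : 0 <= c -> 0 < e ->
  exists N, forall n, (N <= n)%N -> `|Q n| * c < e.
Proof.
move=> c0 e0; have c1 : 0 < c + 1 by rewrite ltr_wpDl.
have [N HN] := cvgn_dist_lt Q0 (divr_gt0 e0 c1).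
exists N => n /HN; rewrite subr0 (invprodE adm) normr_id ltr_pdivlMr // => h.
by apply: le_lt_trans h; rewrite ler_wpM2l // lerDl.
Qed.

Lemma seq_norm_bound (La : seq vec) : exists2 M : R, 0 <= M & forall l, l \in La -> `|l| <= M.
Proof.
elim: La => [|a La [M M0 HM]]; first by exists 0.
exists (Num.max `|a| M) => [|l]; first by rewrite le_max M0 orbT.
by rewrite inE le_max => /orP[/eqP ->|/HM ->]; rewrite ?lexx ?orbT.
Qed.

Variables (nuJ : nat -> probability (Rd R d) R) (nj : nat -> nat).
Hypothesis nj_incr : forall j, (nj j < nj j.+1)%N.

Lemma nj_ge j : (j <= nj j)%N.
Proof. by elim: j => // j IH; exact: leq_ltn_trans IH (nj_incr j). Qed.

Definition spectral_at n (La : seq vec) :=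
  [/\ 0 \in La, forall l, l \in La -> Zd l & finspec (convpts 0 n) La].

Definition bounded_below (e : R) j (La : seq vec) :=
  forall l, l \in La -> e <= nsq (fhat (nuJ j) ((Q (nj j))^T *m l)).

Variables (e delta : R) (J : nat).
Hypothesis d0 : 0 < delta.
Hypothesis equi : forall j xi, (J <= j)%N -> exists k : vec, [/\ Zd k, xi = 0 -> k = 0 &
    forall y, `|y| < delta -> e <= nsq (fhat (nuJ j) (xi + k + y))].

Lemma spectral_extend b n La : spectral_at n La -> exists j La',
  [/\ (b <= j)%N, spectral_at (nj j) La', bounded_below e j La' & {subset La <= La'}].
Proof.
move=> [La0 ZLa FLa].
have [M M0 HM] := seq_norm_bound La.
(* The product [d M] bounds [d |a|] for every old frequency [a], the [d] coming from
   [norm_mulmx]. *)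
have [N HN] := norm_invprod_small (mulr_ge0 (ler0n R d) M0) d0.
pose j := maxn (maxn b J) (maxn N n).
have [bj Jj] : (b <= j /\ J <= j)%N by rewrite /j !leq_max !leqnn !orbT.
have [Nj nj'] : (N <= j /\ n <= j)%N by rewrite /j !leq_max !leqnn !orbT.
pose k := (nj j - n)%N.
have njE : nj j = (n + k)%N by rewrite subnKC // (leq_trans nj') // nj_ge.
have [L [L0 ZL FL]] := convpts_finspec adm Bs0 n k.
have [kf Hkf] := choice (fun xi => equi xi Jj).
pose P0 := prodR 0 n; pose P1 := prodR n k.
have uP0 : P0 \in unitmx := prodR_unit adm 0 n.
have uP1 : P1 \in unitmx := prodR_unit adm n k.
(* [W l] is the frequency at which the tail after [nj j] sees the block frequency [l]. Adding
   [P1^T k] to [l] moves it by exactly [k] and is invisible on the atoms of the block. *)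
pose W (l : vec) := (invmx P1)^T *m l.
pose Lt := [seq l + P1^T *m kf (W l) | l <- L].
have Zkf xi : Zd (kf xi) by have [] := Hkf xi.
have FLt : finspec (convpts n k) Lt.
  apply: finspec_shift => //; first exact: convpts_neq0.
  move=> l x lL xs; rewrite -chi_mulr; apply: chi_int => //.
  exact: convpts_int.
have ZLt l : l \in Lt -> Zd l.
  move=> /mapP[l' l'L ->]; apply: ZdD; first exact: ZL.
  exact: Zd_prodR_tr.
have Lt0 : 0 \in Lt.
  have kf0 : kf (W 0) = 0 by have [_ + _] := Hkf (W 0); apply; rewrite /W mulmx0.
  by apply/mapP; exists 0 => //; rewrite kf0 mulmx0 addr0.
exists j, [seq l + P0^T *m l' | l <- La, l' <- Lt]; split=> //.
- split.
  + by apply/allpairsP; exists (0, 0); split=> //=; rewrite mulmx0 addr0.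
  + move=> l /allpairsP[[a a'] /= [aL aL' ->]]; apply: ZdD; first exact: ZLa.
    by apply: Zd_prodR_tr; exact: ZLt.
  + rewrite njE (convpts_cat adm) add0n; apply: finspec_prod => //.
    * exact: convpts_neq0.
    * exact: convpts_neq0.
    * by move=> x; exact: convpts_int.
- move=> _ /allpairsP[[a a'] /= [aL /mapP[l lL ->] ->]].
  (* The block contributes the good translate [W l + kf (W l)] exactly; the old frequency [a] only
     adds a perturbation shorter than [delta]. *)
  have E : (Q (nj j))^T *m (a + P0^T *m (l + P1^T *m kf (W l))) =
      W l + kf (W l) + (Q (nj j))^T *m a.
    rewrite mulmxDr addrC; congr (_ + _).
    rewrite {1}njE (prodR_add R Rs 0) add0n -/P0 -/P1 invmx_mul // trmx_mul -mulmxA.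
    rewrite (mulmxA _ P0^T) -trmx_mul mulmxV // trmx1 mul1mx mulmxDr; congr (_ + _).
    by rewrite mulmxA -trmx_mul mulmxV // trmx1 mul1mx.
  rewrite E; have [_ _] := Hkf (W l); apply.
  apply: le_lt_trans (norm_mulmx _ _) _; rewrite norm_trmx.
  apply: le_lt_trans (HN (nj j) (leq_trans Nj (nj_ge j))).
  by rewrite [d%:R * _]mulrC -mulrA ler_wpM2l // ler_wpM2l // HM.
- by move=> l lL; apply/allpairsP; exists (l, 0); split=> //=; rewrite mulmx0 addr0.
Qed.

Lemma spectral_sequence : exists (jj : nat -> nat) (La : nat -> seq vec),
  [/\ forall i, (i <= jj i)%N, forall i, spectral_at (nj (jj i)) (La i),
      forall i, bounded_below e (jj i) (La i) &
      forall i k, (i <= k)%N -> {subset La i <= La k}].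
Proof.
(* Dependent choice through a total [g], with a default value where the invariant fails. The first
   entry of the triple is a lower bound for the next index; in the recursion it yields
   [i <= jj i]. *)
have /choice[g Hg] (p : nat * nat * seq vec) : exists r : nat * seq vec,
    spectral_at p.1.2 p.2 -> [/\ (p.1.1 <= r.1)%N, spectral_at (nj r.1) r.2,
      bounded_below e r.1 r.2 & {subset p.2 <= r.2}].
  have [H|H] := pselect (spectral_at p.1.2 p.2); last by exists (0%N, [::]).
  by have [j [La' HH]] := spectral_extend p.1.1 H; exists (j, La').
pose r := fix r (i : nat) : nat * seq vec :=
  if i is i'.+1 then g (i, nj (r i').1, (r i').2) else g (0%N, 0%N, [:: 0]).
have S0 : spectral_at 0 [:: 0].
  split=> [|l|]; first by rewrite mem_head.
    by rewrite inE => /eqP ->; exact: Zd0.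
  split=> // [l k|phi].
    by rewrite !inE => /eqP -> /eqP ->; rewrite eqxx.
  by rewrite !big_seq1 chi0l mulr1 mul1r.
have Hr i : [/\ (i <= (r i).1)%N, spectral_at (nj (r i).1) (r i).2 &
    bounded_below e (r i).1 (r i).2].
  elim: i => [|i [_ IH _]]; first by have [] := Hg (0%N, 0%N, [:: 0]) S0.
  by have [] := Hg (i.+1, nj (r i).1, (r i).2) IH.
exists (fun i => (r i).1), (fun i => (r i).2); split.
- by move=> i; have [] := Hr i.
- by move=> i; have [] := Hr i.
- by move=> i; have [] := Hr i.
- move=> i k /subnK <-; elim: (k - i)%N => // a IH l /IH lin.
  have [_ H _] := Hr (a + i)%N.
  by have [_ _ _ Hs] := Hg ((a + i).+1, nj (r (a + i)).1, (r (a + i)).2) H; exact: Hs.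
Qed.

End Construction.

(** * Averages over finite lists *)

Section Averages.
Variables (R : realType) (d : nat).
Notation vec := 'cV[R]_d.
Implicit Types (s : seq vec) (f g : vec -> R).

Lemma avg_le s f g : (forall x, x \in s -> f x <= g x) -> avg s f <= avg s g.
Proof.
by move=> H; rewrite /avg ler_wpM2l ?invr_ge0 // big_seq [leRHS]big_seq ler_sum.
Qed.

Lemma avgD s f g : avg s (fun x => f x + g x) = avg s f + avg s g.
Proof. by rewrite /avg big_split /= mulrDr. Qed.

Lemma avgZ s (c : R) f : avg s (fun x => c * f x) = c * avg s f.
Proof. by rewrite /avg -mulr_sumr mulrCA. Qed.

Lemma avg_cst s (c : R) : s != [::] -> avg s (fun=> c) = c.
Proof.
move=> s0; have n0 : (size s)%:R != 0 :> R by rewrite pnatr_eq0 size_eq0.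
by rewrite /avg big_const_seq count_predT iter_addr_0 -(mulr_natl c) mulKf.
Qed.

Lemma Re_avg s (F : vec -> R[i]) :
  Re (Complex (size s)%:R^-1 0 * \sum_(x <- s) F x) = avg s (fun x => Re (F x)).
Proof. by rewrite ReM Re_sum /= mul0r subr0. Qed.

End Averages.

(* AM-GM. *)
Lemma Re_mul_le (R : realType) (z w : R[i]) (t : R) : 0 < t ->
  Re (z * w) <= (2 * t)^-1 * nsq z + t / 2 * nsq w.
Proof.
move=> t0; rewrite -subr_ge0.
have -> : (2 * t)^-1 * nsq z + t / 2 * nsq w - Re (z * w) =
    (2 * t)^-1 * ((Re z - t * Re w) ^+ 2 + (Im z + t * Im w) ^+ 2).
  by rewrite ReM /nsq; field; rewrite gt_eqF.
by rewrite mulr_ge0 ?addr_ge0 ?sqr_ge0 // invr_ge0 mulr_ge0 // ltW.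
Qed.

(** * The quantitative estimate at one level of the construction *)

Section MainEstimate.
Variables (R : realType) (d : nat).
Notation vec := 'cV[R]_d.
Notation bc := (@bounded_continuous R d).
Variables (mu nun : probability (Rd R d) R) (s La : seq vec) (Q : 'M[R]_d) (e : R).
Hypothesis s0 : s != [::].
Hypothesis conv : forall f, bc f -> Rintegral mu setT f =
  avg s (fun x => Rintegral nun setT (fun y => f (x + Q *m y))).
Hypothesis FLa : finspec s La.
Hypothesis e0 : 0 < e.
Hypothesis pos : forall l, l \in La -> e <= nsq (fhat nun (Q^T *m l)).
Hypothesis ortho : forall l k, l \in La -> k \in La -> fhat mu (l - k) = (l == k)%:R.

Variables (phi : vec -> R[i]).
Hypothesis bphi : cbc phi.

Let N : R[i] := Complex (size s)%:R^-1 0.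
Let w (l : vec) : R[i] := fhat nun (Q^T *m l).
Let a (l : vec) : R[i] := N * \sum_(x <- s) phi x * chi l x.
Let b (l : vec) : R[i] := conjc (a l) / w l.
(* The conjugate of the test polynomial [T]. *)
Let S (z : vec) : R[i] := \sum_(l <- La) b l * chi l z.

Let bS : cbc S.
Proof. by apply: cbc_sum => l; apply: cbc_mul; [exact: cbc_cst|exact: cbc_chi]. Qed.

Let w0 l : l \in La -> w l != 0.
Proof. by move=> lL; rewrite -nsq_eq0 gt_eqF // (lt_le_trans e0) // pos. Qed.

Let sum_a : \sum_(l <- La) nsq (a l) = avg s (fun x => nsq (phi x)).
Proof.
have n0 : (size s)%:R != 0 :> R by rewrite pnatr_eq0 size_eq0.
have [_ _ Pv] := FLa.
under eq_bigr => l _ do rewrite /a nsqM.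
rewrite -mulr_sumr Pv /avg mulrA; congr (_ * _).
by rewrite /nsq /= expr0n addr0 expr2 -mulrA mulVf ?mulr1.
Qed.

Let sum_b : \sum_(l <- La) nsq (b l) <= e^-1 * avg s (fun x => nsq (phi x)).
Proof.
rewrite -sum_a mulr_sumr big_seq [leRHS]big_seq; apply: ler_sum => l lL.
rewrite /b nsqM nsq_conjc nsqV mulrC ler_wpM2r ?nsq_ge0 //.
by rewrite lef_pV2 ?posrE // ?pos // (lt_le_trans e0) // pos.
Qed.

Let norm_S : Rintegral mu setT (fun z => nsq (S z)) = \sum_(l <- La) nsq (b l).
Proof.
have [uLa _ _] := FLa.
have E : cint mu (fun z => S z * conjc (S z)) =
    \sum_(l <- La) Complex (nsq (b l)) 0.
  have -> : (fun z => S z * conjc (S z)) = (fun z =>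
      \sum_(l <- La) \sum_(k <- La) (b l * conjc (b k)) * chi (l - k) z).
    apply/funext => z; rewrite /S rmorph_sum mulr_suml; apply: eq_bigr => l _.
    rewrite mulr_sumr; apply: eq_bigr => k _.
    by rewrite rmorphM chiDl chiN; ring.
  have cb l k : cbc (fun z => (b l * conjc (b k)) * chi (l - k) z).
    by apply: cbc_mul; [exact: cbc_cst|exact: cbc_chi].
  rewrite cint_sum; last by move=> l; apply: cbc_sum => k.
  rewrite big_seq [RHS]big_seq; apply: eq_bigr => l lL.
  rewrite cint_sum //.
  have ce k : cint mu (fun z => (b l * conjc (b k)) * chi (l - k) z) =
      b l * conjc (b k) * fhat mu (l - k) by rewrite cint_scale //; exact: cbc_chi.
  under eq_bigr => k _ do rewrite ce.
  rewrite (bigD1_seq l) //= ortho // eqxx mulr1 big_seq_cond big1.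
    by rewrite addr0 nsqE.
  move=> k /andP[kL kl]; rewrite ortho //.
  by rewrite eq_sym (negPf kl) mulr0.
have := congr1 (@complex.Re R) E; rewrite Re_sum /= => <-; congr Rintegral.
by apply/funext => z; rewrite -nsqE.
Qed.

(** Here [phi] is taken at the atom [x] but [S] at [x + Q y]. Integrating over [y] turns
    [chi l (x + Q y)] into [chi l x] times [w l], which cancels the denominator of [b l] and leaves
    the sum of the [|a l|^2]. *)
Let pairing : avg s (fun x => Rintegral nun setT (fun y => Re (phi x * S (x + Q *m y))))
  = avg s (fun x => nsq (phi x)).
Proof.
rewrite -sum_a.
have -> : avg s (fun x => Rintegral nun setT (fun y => Re (phi x * S (x + Q *m y)))) =
    Re (N * \sum_(x <- s) cint nun (fun y => phi x * S (x + Q *m y))).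
  by rewrite Re_avg.
have -> : N * \sum_(x <- s) cint nun (fun y => phi x * S (x + Q *m y)) =
    \sum_(l <- La) Complex (nsq (a l)) 0.
  transitivity (N * \sum_(x <- s) \sum_(l <- La) (phi x * chi l x) * (b l * w l)).
    congr (_ * _); apply: eq_bigr => x _.
    rewrite cint_scale; last exact: (cbc_affine x Q bS).
    have -> : (fun y => S (x + Q *m y)) =
        (fun y => \sum_(l <- La) (b l * chi l x) * chi (Q^T *m l) y).
      apply/funext => y; apply: eq_bigr => l _.
      by rewrite chiDr chi_mulr mulrA.
    rewrite cint_sum; last first.
      by move=> l; apply: cbc_mul; [exact: cbc_cst|exact: cbc_chi].
    rewrite mulr_sumr; apply: eq_bigr => l _.
    rewrite cint_scale; last exact: cbc_chi.
    by rewrite -/(fhat nun (Q^T *m l)) -/(w l); ring.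
  rewrite exchange_big mulr_sumr /= big_seq [RHS]big_seq; apply: eq_bigr => l lL.
  rewrite -mulr_suml mulrA -/(a l) /b divfK ?w0 //.
  by rewrite nsqE.
by rewrite Re_sum.
Qed.

Variables (u v : Rd R d -> R).
Hypothesis mu_u : measurable_fun setT u.
Hypothesis mu_v : measurable_fun setT v.
Hypothesis u2 : mu.-integrable setT (fun x => (u x ^+ 2)%:E).
Hypothesis v2 : mu.-integrable setT (fun x => (v x ^+ 2)%:E).
Hypothesis uv_orth : forall l, l \in La ->
  Rintegral mu setT (fun x => u x * cos (2 * pi * dotv l x)
                              + v x * sin (2 * pi * dotv l x)) = 0 /\
  Rintegral mu setT (fun x => v x * cos (2 * pi * dotv l x)
                              - u x * sin (2 * pi * dotv l x)) = 0.

Lemma L2_mul_bc_integrable (f : Rd R d -> R) (g : vec -> R) : measurable_fun setT f ->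
  mu.-integrable setT (fun x => (f x ^+ 2)%:E) -> bc g ->
  mu.-integrable setT (EFin \o (fun x => f x * g x)).
Proof.
move=> mf f2 bg; have mg := bc_measurable bg.
have g2 : mu.-integrable setT (EFin \o (fun x : Rd R d => g x ^+ 2)).
  by apply: bc_integrable; exact: bc_mul.
apply: (le_integrable measurableT _ _ (integrableD measurableT f2 g2)).
  by apply/measurable_EFinP; exact: measurable_funM.
move=> x _; rewrite /= lee_fin normrM [leRHS]ger0_norm ?addr_ge0 ?sqr_ge0 //.
have := sqr_ge0 (`|f x| - `|g x|).
have := sqr_ge0 (f x); have := sqr_ge0 (g x).
rewrite -[f x ^+ 2]real_normK ?num_real // -[g x ^+ 2]real_normK ?num_real //.
by nra.
Qed.

(** [G] is the real part of [(u + i v)] times the partial sum of [S] over [r], written with cosines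
    and sines. Integrability is carried through the induction because additivity of the integral
    requires it. *)
Lemma Rint_orth_sum (r : seq vec) : {subset r <= La} ->
  let G x := \sum_(l <- r) (Re (b l) * (u x * cos (2 * pi * dotv l x)
                              + v x * sin (2 * pi * dotv l x))
             - Im (b l) * (v x * cos (2 * pi * dotv l x)
                              - u x * sin (2 * pi * dotv l x))) in
  mu.-integrable setT (EFin \o G) /\ Rintegral mu setT G = 0.
Proof.
elim: r => [_|l r IH sub] /=.
  under eq_fun do rewrite big_nil; rewrite Rint_cst; split=> //.
  by apply: (bc_integrable mu (f := fun=> 0)); exact: bc_cst.
have sub' : {subset r <= La} by move=> k kr; apply: sub; rewrite inE kr orbT.
have [iG G0] := IH sub'.
have [E1 E2] := uv_orth (sub l (mem_head _ _)).
have bcos := bc_cos l; have bsin := bc_sin l.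
have i1 := L2_mul_bc_integrable mu_u u2 bcos.
have i2 := L2_mul_bc_integrable mu_v v2 bsin.
have i3 := L2_mul_bc_integrable mu_v v2 bcos.
have i4 := L2_mul_bc_integrable mu_u u2 bsin.
have j1 := integrableD measurableT i1 i2.
have j2 := integrableB measurableT i3 i4.
have k1 := integrableZl measurableT (Re (b l)) j1.
have k2 := integrableZl measurableT (Im (b l)) j2.
have k3 := integrableB measurableT k1 k2.
under eq_fun do rewrite big_cons.
split; first exact: (integrableD measurableT k3 iG).
rewrite RintegralD // G0 addr0 RintegralB // !RintegralZl //.
by rewrite E1 E2 !mulr0 subr0.
Qed.

Let f (x : Rd R d) : R[i] := Complex (u x) (v x).

Lemma nsq_dist_integrable :
  mu.-integrable setT (EFin \o (fun x => nsq (phi x - f x))).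
Proof.
have [bR bI] := bphi.
have H (g : Rd R d -> R) (p : vec -> R) : measurable_fun setT g ->
    mu.-integrable setT (fun x => (g x ^+ 2)%:E) -> bc p ->
    mu.-integrable setT (EFin \o (fun x => (p x - g x) ^+ 2)).
  move=> mg g2 bp; have mp := bc_measurable bp.
  have p2 : mu.-integrable setT (EFin \o (fun x : Rd R d => p x ^+ 2)).
    by apply: bc_integrable; exact: bc_mul.
  apply: (le_integrable measurableT _ _
    (integrableZl measurableT 2 (integrableD measurableT p2 g2))).
    by apply/measurable_EFinP; apply: measurable_funX; exact: measurable_funB.
  move=> x _; rewrite /= lee_fin (ger0_norm (sqr_ge0 _)) ger0_norm; last first.
    by rewrite mulr_ge0 // addr_ge0 // sqr_ge0.
  by have := sqr_ge0 (p x + g x); nra.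
have := integrableD measurableT (H _ _ mu_u u2 bR) (H _ _ mu_v v2 bI).
congr (_.-integrable _ _); apply/funext => x /=; rewrite -EFinD; congr EFin.
by rewrite /nsq /f; case: (phi x).
Qed.

Lemma main_estimate :
  avg s (fun x => nsq (phi x)) <= 2 / e *
    (Rintegral mu setT (fun x => nsq (phi x - f x)) +
     avg s (fun x => Rintegral nun setT (fun y => nsq (phi (x + Q *m y) - phi x)))).
Proof.
set A := avg s _; set D := Rintegral mu setT _; set err := avg s _.
(* Weight for AM-GM: each of the two terms [t / 2 * X] is then at most [A / 4], so half of [A]
   survives, and [(2 t)^-1 = e^-1] produces the final [2 / e]. *)
pose t := e / 2; have t0 : 0 < t by rewrite divr_gt0.
set X := Rintegral mu setT (fun z => nsq (S z)).
have XA : X <= e^-1 * A by rewrite /X norm_S; exact: sum_b.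
have bSphi : cbc (fun z => phi z * S z) by exact: cbc_mul.
have bX : bc (fun z => nsq (S z)) := bc_nsq bS.
have scale c (g : vec -> R) : bc g -> bc (fun x => c * g x).
  by move=> bg; apply: bc_mul => //; exact: bc_cst.
(* By orthogonality [phi] may be replaced by [phi - f] in the pairing with [S]. *)
have up : Rintegral mu setT (fun z => Re (phi z * S z)) <= (2 * t)^-1 * D + t / 2 * X.
  have [iG G0] := Rint_orth_sum (fun l lL => lL : l \in La).
  have GE x : \sum_(l <- La) (Re (b l) * (u x * cos (2 * pi * dotv l x)
                              + v x * sin (2 * pi * dotv l x))
             - Im (b l) * (v x * cos (2 * pi * dotv l x)
                              - u x * sin (2 * pi * dotv l x))) = Re (f x * S x).
    rewrite /S mulr_sumr Re_sum; apply: eq_bigr => l _.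
    move: (b l) => bl; rewrite !ReM !ImM.
    have [-> ->] : Re (chi l x) = cos (2 * pi * dotv l x) /\
        Im (chi l x) = - sin (2 * pi * dotv l x).
      by rewrite /chi /expi cosN sinN.
    have [-> ->] : Re (f x) = u x /\ Im (f x) = v x by [].
    by ring.
  rewrite -[leLHS]subr0 -G0 -RintegralB //; last exact: (bc_integrable mu (proj1 bSphi)).
  have iD := nsq_dist_integrable.
  have iX : mu.-integrable setT (EFin \o (fun z : Rd R d => nsq (S z))) := bc_integrable mu bX.
  have k1 := integrableZl measurableT (2 * t)^-1 iD.
  have k2 := integrableZl measurableT (t / 2) iX.
  rewrite /D /X -!RintegralZl // -RintegralD //.
  apply: le_Rintegral => //.
  - exact: (integrableB measurableT (bc_integrable mu (proj1 bSphi)) iG).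
  - exact: (integrableD measurableT k1 k2).
  - move=> x _; rewrite GE.
    have -> : Re (phi x * S x) - Re (f x * S x) = Re ((phi x - f x) * S x).
      by rewrite !ReM; case: (phi x) => *; case: (f x) => * /=; ring.
    exact: Re_mul_le.
(* Replacing [phi (x + Q y)] by [phi x] makes the pairing equal to [A]; AM-GM bounds the cost of the
   replacement. *)
have lo : A - (2 * t)^-1 * err - t / 2 * X <= Rintegral mu setT (fun z => Re (phi z * S z)).
  rewrite conv; last exact: (proj1 bSphi).
  rewrite /X conv // /A -pairing /err.
  rewrite !lerBlDr -!avgZ -!avgD; apply: avg_le => x _.
  have b1 : bc (fun y => Re (phi (x + Q *m y) * S (x + Q *m y))).
    exact: (bc_affine x Q (proj1 bSphi)).
  have b2 : bc (fun y => nsq (phi (x + Q *m y) - phi x)).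
    apply: bc_nsq; apply: cbc_add; first exact: (cbc_affine x Q bphi).
    exact: cbc_cst.
  have b3 : bc (fun y => nsq (S (x + Q *m y))) := bc_affine x Q bX.
  have b4 : bc (fun y => Re (phi x * S (x + Q *m y))).
    apply: (proj1 (_ : cbc _)); apply: cbc_mul; first exact: cbc_cst.
    exact: (cbc_affine x Q bS).
  rewrite -!Rint_scale // -!Rint_add //; try exact: scale;
    try by apply: bc_add => //; exact: scale.
  apply: Rint_le => //; first by apply: bc_add; [apply: bc_add => //; exact: scale|exact: scale].
  move=> y; set z := x + Q *m y.
  have := Re_mul_le (phi x - phi z) (S z) t0.
  have -> : nsq (phi x - phi z) = nsq (phi z - phi x).
    by rewrite /nsq; case: (phi x) => *; case: (phi z) => * /=; ring.
  have -> : Re ((phi x - phi z) * S z) = Re (phi x * S z) - Re (phi z * S z).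
    by rewrite !ReM; case: (phi x) => *; case: (phi z) => * /=; ring.
  by move=> h; lra.
have tE : (2 * t)^-1 = e^-1 by rewrite /t mulrC divfK.
have tX : t / 2 * X <= A / 4.
  apply: (@le_trans _ _ (t / 2 * (e^-1 * A))); first by rewrite ler_wpM2l // divr_ge0 // ltW.
  by rewrite /t le_eqVlt; apply/orP; left; apply/eqP; field; rewrite gt_eqF.
rewrite tE in up lo.
rewrite -[2 / e]/(2 * e^-1) -mulrA mulrDr.
by lra.
Qed.

End MainEstimate.

(** * Completeness in [L^2(mu)] *)

Section Completeness.
Variables (R : realType) (d : nat).
Notation vec := 'cV[R]_d.

(** If [M] bounds both [g] and its Lipschitz constant, the squared increment is at most [(2 M)^2]
    and at most [2 M] times [M |w|], hence at most [4 M^2 min 1 |w|]. The truncated norm is the form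
    in which the tails can integrate this. *)
Lemma nsq_lipb_dist (p q : vec -> R) : lipb p -> lipb q -> exists2 K : R, 0 <= K &
  forall (x w y : vec) (eta : R), `|w| <= eta * `|y| ->
    nsq (Complex (p (x + w)) (q (x + w)) - Complex (p x) (q x)) <= K * tnorm eta y.
Proof.
have H (g : vec -> R) : lipb g -> exists2 K : R, 0 <= K &
    forall (x w y : vec) (eta : R), `|w| <= eta * `|y| ->
      (g (x + w) - g x) ^+ 2 <= K * tnorm eta y.
  move=> [M [gM gL]]; have M0 : 0 <= M := le_trans (normr_ge0 _) (gM 0).
  exists (4 * M ^+ 2) => [|x w y eta wy]; first by rewrite mulr_ge0 ?sqr_ge0.
  have h1 : `|g (x + w) - g x| <= 2 * M.
    by rewrite (le_trans (ler_normB _ _)) //; have := gM (x + w); have := gM x; lra.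
  have h2 : `|g (x + w) - g x| <= M * `|w| by have := gL (x + w) x; rewrite addrAC subrr add0r.
  have w0 := normr_ge0 w; have g0 := normr_ge0 (g (x + w) - g x).
  rewrite -[leLHS]real_normK ?num_real //.
  set c := `|g (x + w) - g x| in h1 h2 g0 *.
  apply: (@le_trans _ _ (4 * M ^+ 2 * Num.min 1 `|w|)).
    rewrite /Num.min; case: ltP => h; first by nra.
    apply: (@le_trans _ _ ((2 * M) * (M * `|w|))); first by rewrite expr2 ler_pM.
    have : 0 <= M ^+ 2 * `|w| by rewrite mulr_ge0 ?sqr_ge0.
    by nra.
  rewrite ler_wpM2l ?mulr_ge0 ?sqr_ge0 // /tnorm le_min !ge_min lexx /=.
  by rewrite wy orbT.
move=> /H[K K0 HK] /H[L L0 HL]; exists (K + L); first exact: addr_ge0.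
by move=> x w y eta wy; rewrite mulrDl lerD // ?HK ?HL.
Qed.

Lemma nsq_L2_approx (P : probability (Rd R d) R) (u v : Rd R d -> R) (eta : R) :
  measurable_fun setT u -> measurable_fun setT v ->
  P.-integrable setT (fun x => (u x ^+ 2)%:E) ->
  P.-integrable setT (fun x => (v x ^+ 2)%:E) -> 0 < eta ->
  exists p q : vec -> R, [/\ lipb p, lipb q &
    Rintegral P setT (fun x => nsq (Complex (p x) (q x) - Complex (u x) (v x))) < eta].
Proof.
move=> mu_u mu_v u2 v2 eta0; have e2 : 0 < eta / 2 by rewrite divr_gt0.
have [_ /(_ _ e2)[p [lp up]]] := L2_approximable mu_u u2.
have [_ /(_ _ e2)[q [lq vq]]] := L2_approximable mu_v v2.
exists p, q; split=> //.
have mp := lipb_measurable lp; have mq := lipb_measurable lq.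
have E : (\int[P]_x (nsq (Complex (p x) (q x) - Complex (u x) (v x)))%:E =
    sqnorm P (fun x => u x - p x)%R + sqnorm P (fun x => v x - q x)%R)%E.
  rewrite /sqnorm -ge0_integralD //; try by move=> x _; rewrite lee_fin sqr_ge0.
  - apply: eq_integral => x _; rewrite -EFinD; congr EFin.
    by rewrite /nsq /=; ring.
  - by apply: measurable_sqr; exact: measurable_funB.
  - by apply: measurable_sqr; exact: measurable_funB.
have lt : (\int[P]_x (nsq (Complex (p x) (q x) - Complex (u x) (v x)))%:E < eta%:E)%E.
  by rewrite E [eta]splitr EFinD; exact: lteD.
rewrite -lte_fin /Rintegral fineK // ge0_fin_numE; first exact: lt_trans lt (ltry _).
by apply: integral_ge0 => x _; rewrite lee_fin nsq_ge0.
Qed.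

Variables (Rs : nat -> 'M[int]_d) (Bs : nat -> seq 'cV[int]_d).
Variables (mu nu : probability (Rd R d) R) (nuJ : nat -> probability (Rd R d) R).
Variables (nj jj : nat -> nat) (La : nat -> seq vec) (e : R).
Hypothesis adm : forall n, admissible R (Rs n) (Bs n).
Hypothesis mu_lim : weak_conv_pts (fun n => convpts R Rs Bs 0 n) mu.
Hypothesis Q0 : (fun n => `|invprod R Rs n|) @ \oo --> (0 : R).
Hypothesis nuJ_tail : forall j,
  weak_conv_pts (fun k => convpts R Rs Bs (nj j) k) (nuJ j).
Hypothesis nj_incr : forall j, (nj j < nj j.+1)%N.
Hypothesis nuJ_lim : weak_conv nuJ nu.
Hypothesis jj_ge : forall i, (i <= jj i)%N.
Hypothesis e0 : 0 < e.
Hypothesis La_spec : forall i, spectral_at Rs Bs (nj (jj i)) (La i).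
Hypothesis La_below : forall i, bounded_below Rs nuJ nj e (jj i) (La i).
Hypothesis ortho : forall i l k, l \in La i -> k \in La i ->
  fhat mu (l - k) = (l == k)%:R.
Variables (u v : Rd R d -> R).
Hypothesis mu_u : measurable_fun setT u.
Hypothesis mu_v : measurable_fun setT v.
Hypothesis u2 : mu.-integrable setT (fun x => (u x ^+ 2)%:E).
Hypothesis v2 : mu.-integrable setT (fun x => (v x ^+ 2)%:E).
Hypothesis uv_orth : forall i l, l \in La i ->
  Rintegral mu setT (fun x => u x * cos (2 * pi * dotv l x)
                              + v x * sin (2 * pi * dotv l x)) = 0 /\
  Rintegral mu setT (fun x => v x * cos (2 * pi * dotv l x)
                              - u x * sin (2 * pi * dotv l x)) = 0.

(** The two [theta] pay for two limits: inside the bracket for freezing [phi] at the atoms, outside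
    for replacing the integral of [|phi|^2] by its average over [mu_n]. *)
Lemma lipb_frame_bound (p q : vec -> R) (theta : R) : lipb p -> lipb q -> 0 < theta ->
  Rintegral mu setT (fun x => nsq (Complex (p x) (q x))) <= 2 / e *
    (Rintegral mu setT (fun x => nsq (Complex (p x) (q x) - Complex (u x) (v x)))
     + theta) + theta.
Proof.
move=> lp lq theta0; pose phi x : R[i] := Complex (p x) (q x); have Bs0 := Bs_neq0 mu_lim.
have bphi : cbc phi by split; exact: lipb_bc.
have [K K0 HK] := nsq_lipb_dist lp lq.
have K1 : 0 < K + 1 by rewrite ltr_wpDl.
(* Half of [theta / (K + 1)] is spent on [nu], half on the passage to [nuJ j]; [K + 1] avoids a
   division by 0. *)
have th : 0 < theta / (K + 1) / 2 by rewrite !divr_gt0.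
have [eta [eta0 Heta]] := tnorm_small nu th.
have bt := bc_tnorm d (ltW eta0).
have [N1 H1] := cvgn_dist_lt (mu_lim (bc_nsq bphi)) theta0.
have [N2 H2] := norm_invprod_small adm Q0 (ler0n R d) eta0.
have [N3 H3] := cvgn_dist_lt (nuJ_lim bt) th.
(* [N1] and [N2] are thresholds for [n], [N3] for [j]; the chain [i <= j <= n] meets all of them. *)
pose i := maxn N1 (maxn N2 N3); pose j := jj i; pose n := nj j.
have ij : (i <= j)%N := jj_ge i.
have jn : (j <= n)%N := nj_ge nj_incr j.
have N1n : (N1 <= n)%N by rewrite (leq_trans _ (leq_trans ij jn)) // leq_maxl.
have N2n : (N2 <= n)%N.
  by rewrite (leq_trans _ (leq_trans ij jn)) // leq_max leq_maxl orbT.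
have N3j : (N3 <= j)%N by rewrite (leq_trans _ ij) // !leq_max leqnn !orbT.
have [_ _ FLa] := La_spec i.
have s0 : convpts R Rs Bs 0 n != [::] by exact: convpts_neq0.
have := main_estimate s0 (Rint_conv adm mu_lim (@nuJ_tail j)) FLa e0 (@La_below i)
  (@ortho i) bphi mu_u mu_v u2 v2 (@uv_orth i).
have := H1 _ N1n; rewrite ltr_distl => /andP[hA _].
set err := avg _ (fun x => Rintegral (nuJ j) setT _).
have Herr : err <= theta.
  have T0 : Rintegral (nuJ j) setT (tnorm eta) <= theta / (K + 1).
    have := H3 _ N3j; rewrite ltr_distl => /andP[_].
    by rewrite [X in _ -> _ <= X]splitr; lra.
  rewrite -(avg_cst theta s0); apply: avg_le => x _.
  apply: (@le_trans _ _ (K * Rintegral (nuJ j) setT (tnorm eta))); last first.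
    apply: (@le_trans _ _ (K * (theta / (K + 1)))); first by rewrite ler_wpM2l.
    by rewrite mulrA ler_pdivrMr // mulrC ler_wpM2l ?lerDl // ltW.
  rewrite -Rint_scale //; apply: Rint_le.
  - apply: bc_nsq; apply: cbc_add; last exact: cbc_cst.
    exact: (cbc_affine x _ bphi).
  - by apply: bc_mul => //; exact: bc_cst.
  - move=> y; apply: HK; apply: le_trans (norm_mulmx _ _) _.
    by rewrite ler_wpM2r // mulrC ltW // H2.
move=> est; apply: (le_trans (ltW _)); first by rewrite ltrBlDr in hA; exact: hA.
rewrite lerD2r; apply: (le_trans est).
by apply: ler_wpM2l; [rewrite divr_ge0 // ltW|rewrite lerD2l].
Qed.

Lemma L2_orth_eq0 : {ae mu, forall x, u x = 0 /\ v x = 0}.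
Proof.
pose f (x : Rd R d) : R[i] := Complex (u x) (v x).
have if2 : mu.-integrable setT (EFin \o (fun x => nsq (f x))).
  exact: (integrableD measurableT u2 v2).
have f0 : Rintegral mu setT (fun x => nsq (f x)) <= 0.
  (* The constant collects [2 (2 / e * (2 eta) + eta) + 2 eta], obtained from [D < eta] and
     [theta = eta]. *)
  suff bound (eta : R) : 0 < eta ->
      Rintegral mu setT (fun x => nsq (f x)) <= (8 / e + 4) * eta.
    have C0 : 0 < 8 / e + 4 by rewrite addr_gt0 // divr_gt0.
    apply/ler_addgt0Pr => c c0; rewrite add0r.
    have := bound _ (divr_gt0 c0 C0).
    by rewrite [X in _ <= X -> _]mulrC divfK // gt_eqF.
  move=> eta0.
  have [p [q [lp lq]]] := nsq_L2_approx mu_u mu_v u2 v2 eta0.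
  pose phi (x : vec) : R[i] := Complex (p x) (q x).
  have bphi : cbc phi by split; exact: lipb_bc.
  pose D := Rintegral mu setT (fun x => nsq (phi x - f x)).
  have hb : Rintegral mu setT (fun x => nsq (phi x)) <= 2 / e * (D + eta) + eta.
    exact: lipb_frame_bound.
  rewrite -[Rintegral _ _ _]/D => Dlt.
  have iD := nsq_dist_integrable bphi mu_u mu_v u2 v2.
  have iphi := bc_integrable mu (bc_nsq bphi).
  have h : Rintegral mu setT (fun x => nsq (f x)) <=
      2 * Rintegral mu setT (fun x => nsq (phi x)) + 2 * D.
    have k1 := integrableZl measurableT 2 iphi.
    have k2 := integrableZl measurableT 2 iD.
    rewrite /D -!RintegralZl // -RintegralD //.
    apply: le_Rintegral => //; first exact: (integrableD measurableT k1 k2).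
    move=> x _; rewrite /nsq /=.
    (* The identity behind it: [2 p^2 + 2 (p - u)^2 - u^2 = (2 p - u)^2]. *)
    have := sqr_ge0 (2 * p x - u x); have := sqr_ge0 (2 * q x - v x).
    by nra.
  have e1 : 0 < e^-1 by rewrite invr_gt0.
  have : 2 / e * (D + eta) <= 2 / e * (eta + eta).
    by rewrite ler_wpM2l ?lerD2r ?divr_ge0 // ltW.
  by rewrite !mulrDl; lra.
have F0 : (\int[mu]_x `|(nsq (f x))%:E| = 0)%E.
  under eq_integral do rewrite gee0_abs ?lee_fin ?nsq_ge0 //.
  have fin := integrable_fin_num measurableT if2.
  apply/eqP; rewrite eq_le; apply/andP; split.
    by rewrite -(fineK fin) lee_fin.
  by apply: integral_ge0 => x _; rewrite lee_fin nsq_ge0.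
have mf : measurable_fun setT (fun x => (nsq (f x))%:E) := measurable_int _ if2.
have := (proj1 (ae_eq_integral_abs mu measurableT mf)) F0.
apply: filterS => x /(_ I) [] /eqP; rewrite nsq_eq0 eq_complex /=.
by move=> /andP[/eqP -> /eqP ->].
Qed.

End Completeness.

(** * Orthonormality, countability and completeness of the union *)

Theorem theorem1p2 (R : realType) (d : nat)
  (Rs : nat -> 'M[int]_d) (Bs : nat -> seq 'cV[int]_d)
  (mu : probability (Rd R d) R)
  (nu_tail : nat -> probability (Rd R d) R)
  (nu : probability (Rd R d) R) (nj : nat -> nat) :
  (forall n, admissible R (Rs n) (Bs n)) ->
  weak_conv_pts (fun n => convpts R Rs Bs 0 n) mu ->
  (fun n => `|invprod R Rs n|) @ \oo --> (0 : R) ->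
  (forall n, (1 <= n)%N -> weak_conv_pts (fun k => convpts R Rs Bs n k) (nu_tail n)) ->
  (forall j, (1 <= nj j)%N) ->
  (forall j, (nj j < nj j.+1)%N) ->
  weak_conv (fun j => nu_tail (nj j)) nu ->
  Zset nu = set0 ->
  exists Lam : set 'cV[R]_d, Lam `<=` @Zd R d /\ is_spectrum mu Lam.
Proof.
move=> adm mu_lim Q0 tail_lim nj1 nj_incr nu_lim nuZ.
have Bs0 := Bs_neq0 mu_lim.
have [e [dl [J [e0 d0 equi]]]] := equi_positivity nu_lim nuZ.
have [jj [La [Hjj Hsp Hbb Hsub]]] := spectral_sequence adm Bs0 Q0 nj_incr d0 equi.
have ortho i l k : l \in La i -> k \in La i -> fhat mu (l - k) = (l == k)%:R.
  move=> lL kL; have [->|ne] := eqVneq l k; first by rewrite subrr fhat0.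
  (* For distinct frequencies the factor coming from the atoms of the finite convolution already
     vanishes. *)
  rewrite (fhat_conv adm mu_lim (tail_lim _ (nj1 (jj i)))).
  by have [_ _ [_ O _]] := Hsp i; rewrite O // mulr0 mul0r.
exists [set l | exists i, l \in La i]; split.
  by move=> l [i lL]; have [_ Z _] := Hsp i; exact: Z.
split.
  have sub : [set l | exists i, l \in La i] `<=` @intmx R d 1 @` setT.
    by move=> l [i lL]; have [_ Z _] := Hsp i; have [k ->] := Z _ lL; exists k.
  apply: (sub_countable (subset_card_le sub)).
  by apply: (sub_countable (card_image_le _ _)); exact: countableP.
split.
  move=> l l' [i lL] [i' lL'].
  have E : fhat mu (l - l') = (l == l')%:R.
    (* As the spectra increase, two frequencies of the union lie in a common one. *)
    apply: (ortho (maxn i i')); [apply: Hsub lL|apply: Hsub lL'].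
      exact: leq_maxl.
    exact: leq_maxr.
  have := E; rewrite fhatE => EE.
  have := congr1 (@complex.Re R) EE; have := congr1 (@complex.Im R) EE => /= hI hR.
  split; first by rewrite hR; case: (l == l').
  by apply/eqP; rewrite -oppr_eq0; apply/eqP; rewrite hI; case: (l == l').
move=> u v mu_u mu_v u2 v2 orth.
apply: (L2_orth_eq0 adm mu_lim Q0 (fun j => tail_lim _ (nj1 j)) nj_incr nu_lim Hjj
  e0 Hsp Hbb ortho) => // i l lL.
by apply: orth; exists i.
Qed.
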